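(* Let $T$ be the operator on $L^2([0,1]^2)$ given by $$T(f)(x,y)=\int_0^1\chi(t,x,y)\,f(t,x)\,dt,$$ where, for distinct $t,x,y\in[0,1]$, $\chi(t,x,y)=0$ if $t<x<y$, $\chi(t,x,y)=2$ if $t>x>y$, and $\chi(t,x,y)=1$ otherwise. The only non-zero eigenvalue of the operator $T$ is $\lambda=1$, and this is a simple eigenvalue. Furthermore, the eigenfunction $\varphi$ of $T$ and the adjoint eigenfunction $\psi$ (the eigenfunction of $T^*$) associated with this eigenvalue are given by $$\varphi(x,y)=e^{-x}\cdot\begin{cases} 1-x & \text{if } 0\le x\le y\le 1, \\ 2-x & \text{if } 0\le y\le x\le 1, \end{cases}\qquad \psi(x,y)=e^{y-1}\cdot\begin{cases} y & \text{if } 0\le x\le y\le 1, \\ y+1 & \text{if } 0\le y\le x\le 1. \end{cases}$$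
   Context: $L^2([0,1]^2)$ is the complex Hilbert space of square-integrable functions with inner product $(f,g)=\int_{[0,1]^2} f\,\overline{g}\,dx\,dy$, and $T^*$ denotes the adjoint of $T$; explicitly $T^*(f)(x,y)=\int_0^1\chi(x,y,u)f(y,u)\,du$. Points with equal coordinates form a null set and are ignored when defining $\chi$. An eigenvalue is simple if it has algebraic multiplicity one. *)

(* Defs.v *)
From HB Require Import structures.
From mathcomp Require Import all_boot all_order all_algebra.
From mathcomp Require Import all_classical all_reals all_analysis.
From mathcomp Require Import complex.

Set Implicit Arguments.
Unset Strict Implicit.
Unset Printing Implicit Defensive.

Import Order.TTheory GRing.Theory Num.Theory.
Import numFieldNormedType.Exports.

Local Open Scope classical_set_scope.
Local Open Scope ring_scope.
Local Open Scope complex_scope.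

Section L2.
Variable R : realType.

Definition unit_interval : set R := `[0, 1].
Definition unit_square : set (R * R) := unit_interval `*` unit_interval.

(* [measurableTypeR R] is [R] with the Borel sigma-algebra. *)
Definition leb : {measure set (measurableTypeR R) -> \bar R} :=
  @lebesgue_measure R.
Definition leb2 :
    {measure set (measurableTypeR R * measurableTypeR R) -> \bar R} :=
  (@lebesgue_measure R \x @lebesgue_measure R)%E.

(* Real and imaginary parts are integrated separately; each [Rintegral] is the
   usual integral as soon as the complex function is absolutely integrable. *)
Definition cintegral d (X : measurableType d) (mu : {measure set X -> \bar R})
    (D : set X) (f : X -> R[i]) : R[i] :=
  (\int[mu]_(x in D) complex.Re (f x)) +i* (\int[mu]_(x in D) complex.Im (f x)).

(* Elements of L^2([0,1]^2) are represented by functions on R * R, of which only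
   the restriction to the unit square matters, and are compared up to [=ae]. *)
Definition memL2 (f : R * R -> R[i]) : Prop :=
  [/\ @measurable_fun _ _ (measurableTypeR R * measurableTypeR R)%type R
        unit_square (fun z => complex.Re (f z)),
      @measurable_fun _ _ (measurableTypeR R * measurableTypeR R)%type R
        unit_square (fun z => complex.Im (f z)) &
      (\int[leb2]_(z in unit_square)
         (complex.Re (f z) ^+ 2 + complex.Im (f z) ^+ 2)%:E < +oo)%E].

Definition eqL2 (f g : R * R -> R[i]) : Prop :=
  {ae leb2, forall z, unit_square z -> f z = g z}.

Local Notation "f =ae g" := (eqL2 f g) (at level 70, no associativity).

Definition inner (f g : R * R -> R[i]) : R[i] :=
  cintegral leb2 unit_square (fun z => f z * (g z)^*).

Definition normL2 (f : R * R -> R[i]) : R :=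
  Num.sqrt (complex.Re (inner f f)).

Definition operator := (R * R -> R[i]) -> (R * R -> R[i]).

(* [A] induces a bounded linear operator on the space of classes modulo [=ae]. *)
Definition bounded_operator (A : operator) : Prop :=
  [/\ forall f, memL2 f -> memL2 (A f),
      forall f g, memL2 f -> memL2 g -> f =ae g -> A f =ae A g,
      forall (c : R[i]) f g, memL2 f -> memL2 g ->
        A (fun z => c * f z + g z) =ae (fun z => c * A f z + A g z) &
      exists M : R, forall f, memL2 f -> normL2 (A f) <= M * normL2 f].

Definition is_adjoint (A B : operator) : Prop :=
  forall f g, memL2 f -> memL2 g -> inner (A f) g = inner f (B g).

Definition eigenfunction (A : operator) (lam : R[i]) (f : R * R -> R[i]) : Prop :=
  [/\ memL2 f, ~ (f =ae (fun=> 0)) & A f =ae (fun z => lam * f z)].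

Definition op_eigenvalue (A : operator) (lam : R[i]) : Prop :=
  exists f, eigenfunction A lam f.

(* "The" eigenfunction: unique up to a scalar factor. *)
Definition the_eigenfunction (A : operator) (lam : R[i])
    (f : R * R -> R[i]) : Prop :=
  eigenfunction A lam f /\
  forall g, eigenfunction A lam g -> exists c : R[i], g =ae (fun z => c * f z).

(* The union over k of the kernels of (A - lam)^k. *)
Definition generalized_eigenspace (A : operator) (lam : R[i])
    (f : R * R -> R[i]) : Prop :=
  memL2 f /\
  exists k : nat, iter k (fun g z => A g z - lam * g z) f =ae (fun=> 0).

Definition algebraic_multiplicity (A : operator) (lam : R[i]) (m : nat) : Prop :=
  exists e : 'I_m -> (R * R -> R[i]),
  [/\ forall i, generalized_eigenspace A lam (e i),
      forall c : 'I_m -> R[i],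
        (fun z => \sum_(i < m) c i * e i z) =ae (fun=> 0) -> forall i, c i = 0 &
      forall f, generalized_eigenspace A lam f ->
        exists c : 'I_m -> R[i], f =ae (fun z => \sum_(i < m) c i * e i z)].

Definition simple_eigenvalue (A : operator) (lam : R[i]) : Prop :=
  op_eigenvalue A lam /\ algebraic_multiplicity A lam 1.

End L2.

Section Operator.
Variable R : realType.

(* Only meaningful for distinct [t], [x], [y]. *)
Definition chi (t x y : R) : R :=
  if (t < x) && (x < y) then 0
  else if (x < t) && (y < x) then 2
  else 1.

Definition opT : operator R := fun f z =>
  let: (x, y) := z in
  cintegral (@leb R) (@unit_interval R) (fun t => (chi t x y)%:C * f (t, x)).

Definition opTadj : operator R := fun f z =>
  let: (x, y) := z in
  cintegral (@leb R) (@unit_interval R) (fun u => (chi x y u)%:C * f (y, u)).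

(* The two cases of each formula overlap on the diagonal, a null set. *)
Definition phi (z : R * R) : R[i] :=
  let: (x, y) := z in
  (expR (- x) * (if x <= y then 1 - x else 2 - x))%:C.

Definition psi (z : R * R) : R[i] :=
  let: (x, y) := z in
  (expR (y - 1) * (if x <= y then y else y + 1))%:C.

End Operator.

(* Main.v *)
(* Off the diagonals [chi t x y = 1_(x < t) + 1_(y < x)], so [T f (x, y)] is
   [a x + 1_(y < x) * b x] with [b x] the integral of [f (t, x)] over all [t] and
   [a x] the one over [t > x]. An eigenfunction has the same shape, and its [a], [b]
   solve a linear differential system on [0, 1] whose boundary conditions force
   the eigenvalue to be 1 and [f] to be a multiple of [phi].
   The reflection [(x, y) |-> (1 - y, 1 - x)] preserves the measure of the square,
   conjugates [T] to its adjoint and sends [phi] to [psi], which transfers all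
   statements to the adjoint. The eigenvalue is simple because the range of
   [T - 1] is orthogonal to [psi] while [(phi, psi) = 1/e]. *)
From HB Require Import structures.
Require Import Defs.
From mathcomp Require Import all_boot all_order all_algebra.
From mathcomp Require Import all_classical all_reals all_analysis.
From mathcomp Require Import complex measurable_realfun lebesgue_measure.
From mathcomp Require Import ring lra.

Set Implicit Arguments.
Unset Strict Implicit.
Unset Printing Implicit Defensive.

Import Order.TTheory GRing.Theory Num.Theory.
Import numFieldNormedType.Exports.

Local Open Scope classical_set_scope.
Local Open Scope ring_scope.
Local Open Scope complex_scope.

(** The kernel is real, so [T] acts separately on real and imaginary parts, and the analysis is done
    for real functions extended by zero off the square; integrals, Fubini and changes of variables
    then range over the whole plane. An eigenvalue may a priori be complex, however, and couples the
    two components: the differential system has four real unknowns, and its uniqueness comes from a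
    conserved quantity. An [L^2] function has integrable columns only for almost every [x], so
    linearity of [T] and the formula with [a] and [b] hold only almost everywhere, and [a], [b] are
    not known to be continuous. They agree almost everywhere with constants minus primitives, and a
    primitive ignores null sets; this is how regularity enters. The adjoint relation avoids a triple
    integral: integrating out [y] turns [(T u, v)] into a one-dimensional integral that the
    reflection, with [u] and [v] exchanged, leaves unchanged. The same formula evaluates
    [(phi, psi)] once [phi] is replaced by [T phi]. *)

Lemma ae_impl d (T : measurableType d) (R : realType)
    (mu : {measure set T -> \bar R}) (P Q : T -> Prop) :
  (forall x, P x -> Q x) -> {ae mu, forall x, P x} -> {ae mu, forall x, Q x}.
Proof. by move=> PQ; apply: filterS. Qed.

Lemma ae_and d (T : measurableType d) (R : realType)
    (mu : {measure set T -> \bar R}) (P Q : T -> Prop) :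
  {ae mu, forall x, P x} -> {ae mu, forall x, Q x} ->
  {ae mu, forall x, P x /\ Q x}.
Proof. by apply: filterS2. Qed.

(** * Measure-preserving maps *)

Section MeasurePreserving.
Context d (T : measurableType d) (R : realType).
Variables (mu : {measure set T -> \bar R}) (phi : T -> T).
Hypotheses (mphi : measurable_fun setT phi)
  (phi_mu : forall A, measurable A -> mu (phi @^-1` A) = mu A).
Let mphi_mixin := isMeasurableFun.Build _ _ _ _ _ mphi.
Let mphi_pack : {mfun T >-> T} := HB.pack phi mphi_mixin.

(** The pushforward of [mu] under [phi] agrees with [mu] on measurable sets, so the change of
    variables for pushforwards becomes an invariance. *)
Lemma ge0_integral_preserving D (f : T -> \bar R) : measurable D ->
  measurable_fun D f -> {in D, forall y, (0 <= f y)%E} ->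
  (\int[mu]_(x in phi @^-1` D) f (phi x) = \int[mu]_(x in D) f x)%E.
Proof.
move=> mD mf f0.
have /= <- := ge0_integral_pushforward (phi := mphi_pack) mphi mu mD mf f0.
by apply: eq_measure_integral => A mA _ /=; rewrite /pushforward phi_mu.
Qed.

Lemma integral_preserving D (f : T -> \bar R) : measurable D ->
  measurable_fun D f ->
  (\int[mu]_(x in phi @^-1` D) f (phi x) = \int[mu]_(x in D) f x)%E.
Proof.
move=> mD mf; rewrite integralE [RHS]integralE.
have fp0 : {in D, forall y, (0 <= f^\+ y)%E} by move=> y _; exact: funepos_ge0.
have fn0 : {in D, forall y, (0 <= f^\- y)%E} by move=> y _; exact: funeneg_ge0.
rewrite -(ge0_integral_preserving mD (measurable_funepos mf) fp0).
rewrite -(ge0_integral_preserving mD (measurable_funeneg mf) fn0).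
by congr (_ - _)%E; apply: eq_integral => x _; rewrite ?(funeposE, funenegE).
Qed.

Lemma ae_preserving (P : T -> Prop) :
  {ae mu, forall x, P x} -> {ae mu, forall x, P (phi x)}.
Proof.
move=> [N [mN N0 PN]]; exists (phi @^-1` N); split.
- by rewrite -[X in measurable X]setTI; exact: mphi.
- by rewrite phi_mu.
- by move=> x /= Px; apply: PN.
Qed.

End MeasurePreserving.

(** * Null sets of a product measure and their sections *)

Section ProductNull.
Context d1 d2 (T1 : measurableType d1) (T2 : measurableType d2) (R : realType).
Variables (m1 : {sigma_finite_measure set T1 -> \bar R})
  (m2 : {sigma_finite_measure set T2 -> \bar R}).

(** The measure of a null set [N] is the integral of the nonnegative function [m2 (xsection N x)],
    which therefore vanishes almost everywhere. *)
Lemma ae_product1 (P : T1 * T2 -> Prop) :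
  {ae (m1 \x m2)%E, forall z, P z} ->
  {ae m1, forall x, {ae m2, forall y, P (x, y)}}.
Proof.
move=> [N [mN N0 PN]].
have mf := measurable_fun_xsection m2 mN.
have : (\int[m1]_x `|m2 (xsection N x)| = 0)%E.
  by under eq_integral do rewrite gee0_abs//; exact: N0.
move/(ae_eq_integral_abs m1 measurableT mf); apply: filterS => x /= /(_ I) Nx.
exists (xsection N x); split => //; first exact: measurable_xsection.
by move=> y /= Pxy; rewrite /xsection/= inE; apply: PN.
Qed.

Lemma ae_product2 (P : T1 * T2 -> Prop) :
  {ae (m1 \x m2)%E, forall z, P z} ->
  {ae m2, forall y, {ae m1, forall x, P (x, y)}}.
Proof.
move=> [N [mN N0 PN]].
have mf := measurable_fun_ysection m1 mN.
have : (\int[m2]_y `|m1 (ysection N y)| = 0)%E.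
  under eq_integral do rewrite gee0_abs//.
  (* [\x^] is the product measure built from the other family of sections; uniqueness on rectangles
     identifies it with [\x]. *)
  rewrite -[LHS]/((m1 \x^ m2)%E N).
  rewrite -(@product_measure_unique _ _ _ _ _ m1 m2 (m1 \x^ m2)%E)//.
  by move=> A B mA mB; rewrite /= product_measure2E.
move/(ae_eq_integral_abs m2 measurableT mf); apply: filterS => y /= /(_ I) Ny.
exists (ysection N y); split => //; first exact: measurable_ysection.
by move=> x /= Pxy; rewrite /ysection/= inE; apply: PN.
Qed.

Lemma ae_product_fst (P : T1 -> Prop) :
  {ae m1, forall x, P x} -> {ae (m1 \x m2)%E, forall z, P z.1}.
Proof.
move=> [N [mN N0 PN]]; exists (N `*` setT); split.
- exact: measurableX.
- transitivity (m1 N * m2 setT)%E; first exact: product_measure1E.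
  by rewrite N0 mul0e.
- by move=> z /= Pz; split => //; apply: PN.
Qed.

Lemma ae_product_sections (N : set (T1 * T2)) : measurable N ->
  {ae m1, forall x, m2 (xsection N x) = 0%E} ->
  {ae (m1 \x m2)%E, forall z, ~ N z}.
Proof.
move=> mN N0; exists N; split => //; last by move=> z /= /contrapT.
rewrite /= /product_measure1 /=.
rewrite (ae_eq_integral (cst 0%E)) ?integral0//.
  exact: measurable_fun_xsection.
by apply: filterS N0 => x /= ->.
Qed.

End ProductNull.

(** * Marginals of an integrable function *)

Section Marginals.
Context d1 d2 (T1 : measurableType d1) (T2 : measurableType d2) (R : realType).
Variables (m1 : {sigma_finite_measure set T1 -> \bar R})
  (m2 : {sigma_finite_measure set T2 -> \bar R}).

(** A real marginal is [fine] of an extended one. Since [fine] sends infinite values to 0, it never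
    increases the absolute value. *)
Lemma integrable_fine d (T : measurableType d) (mu : {measure set T -> \bar R})
    (f : T -> \bar R) : mu.-integrable setT f ->
  mu.-integrable setT (EFin \o (fine \o f)).
Proof.
move=> intf; apply: (le_integrable measurableT _ _ intf).
  apply/measurable_EFinP; apply: measurableT_comp => //.
  exact: measurable_int intf.
by move=> x _ /=; case: (f x) => [r| |] /=; rewrite ?normr0 ?leey.
Qed.

Lemma integral_fine d (T : measurableType d) (mu : {measure set T -> \bar R})
    (f : T -> \bar R) : mu.-integrable setT f ->
  (\int[mu]_x (fine (f x))%:E = \int[mu]_x f x)%E.
Proof.
move=> intf; apply: ae_eq_integral => //.
- exact: measurable_int (integrable_fine intf).
- exact: measurable_int intf.
- apply: filterS (integrable_ae measurableT intf) => x /= /(_ I) fx _.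
  by rewrite fineK.
Qed.

Lemma integrable_fubini_G (f : T1 * T2 -> \bar R) :
  (m1 \x m2)%E.-integrable setT f -> m2.-integrable setT (fubini_G m1 f).
Proof.
move=> intf; have mf := measurable_int _ intf.
have mF : measurable_fun setT (fun y => \int[m1]_x `|f (x, y)|)%E.
  apply: (measurable_fun_fubini_tonelli_G (abse \o f)) => //=.
  exact: measurableT_comp.
have mG := measurable_fubini_G intf.
apply/integrableP; split => //.
apply: le_lt_trans ((integrable21ltyP m1 m2 mf).1 intf).
apply: ge0_le_integral => //; first exact: measurableT_comp.
by move=> y _; apply: le_abse_integral => //; exact: measurableT_comp.
Qed.

Variable h : T1 * T2 -> R.
Hypothesis inth : (m1 \x m2)%E.-integrable setT (EFin \o h).

Lemma integrable_Rmarginal1 :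
  m1.-integrable setT (EFin \o (fun x => \int[m2]_y h (x, y))).
Proof. exact: integrable_fine (integrable_fubini_F inth). Qed.

Lemma integrable_Rmarginal2 :
  m2.-integrable setT (EFin \o (fun y => \int[m1]_x h (x, y))).
Proof. exact: integrable_fine (integrable_fubini_G inth). Qed.

Lemma Rfubini1 :
  \int[m1]_x \int[m2]_y h (x, y) = \int[(m1 \x m2)%E]_z h z.
Proof.
congr fine; rewrite -(integral12_prod_meas1 inth).
by rewrite (integral_fine (integrable_fubini_F inth)).
Qed.

End Marginals.

(** * Square-integrable functions on the unit square *)

Section Measurability.
Context d (T : measurableType d) (R : realType).

Lemma measurable_natr_bool (b : T -> bool) :
  measurable_fun setT b -> measurable_fun setT (fun x => (b x)%:R : R).
Proof.
move=> mb; rewrite (_ : (fun _ => _) = (fun x => if b x then 1 else 0 : R)).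
  exact: measurable_fun_ifT.
by apply/funext => x; case: (b x).
Qed.

(** Tonelli is applied to the positive and negative parts separately, which makes [realT g]
    measurable before anything is known about the integrability of its columns. *)
Lemma measurable_integral_section d' (T' : measurableType d')
    (m : {sigma_finite_measure set T' -> \bar R}) (F : T * T' -> \bar R) :
  measurable_fun setT F -> measurable_fun setT (fun x => \int[m]_t F (x, t))%E.
Proof.
move=> mF; rewrite (_ : (fun _ => _) = (fubini_F m F^\+ \- fubini_F m F^\-)%E).
  apply: emeasurable_funB; apply: measurable_fun_fubini_tonelli_F => //.
    exact: measurable_funepos.
  exact: measurable_funeneg.
apply/funext => x; rewrite integralE /fubini_F.
by congr (_ - _)%E; apply: eq_integral => t _; rewrite ?(funeposE, funenegE).
Qed.

End Measurability.

Section SquareIntegrable.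
Variable R : realType.
Local Notation X := (measurableTypeR R).
Local Notation mu := (@lebesgue_measure R).
Local Notation mu2 := (mu \x mu)%E.
Local Notation I := (@unit_interval R).
Local Notation Q := (@unit_square R).

Lemma measurable_unit_interval : measurable (I : set X).
Proof. exact: measurable_itv. Qed.

Lemma measurable_unit_square : measurable (Q : set (X * X)).
Proof. by apply: measurableX; exact: measurable_unit_interval. Qed.

Lemma lebesgue_unit_interval : mu I = 1%E.
Proof. by rewrite lebesgue_measure_itv/= lte_fin ltr01 sube0. Qed.

Lemma lebesgue_unit_square : mu2 Q = 1%E.
Proof.
transitivity (mu I * mu I)%E; last by rewrite lebesgue_unit_interval mule1.
by apply: product_measure1E; exact: measurable_unit_interval.
Qed.

Lemma integrable_indic_fin d (T : measurableType d)
    (m : {measure set T -> \bar R}) (A : set T) : measurable A ->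
  (m A < +oo)%E -> m.-integrable setT (EFin \o (\1_A : T -> R)).
Proof.
move=> mA Aoo; apply/integrableP; split; first exact/measurable_EFinP.
under eq_integral do rewrite /= ger0_norm//.
by rewrite integral_indic// setIT.
Qed.

Lemma integrable_sqr d (T : measurableType d)
    (m : {measure set T -> \bar R}) (h : T -> R) : measurable_fun setT h ->
  (\int[m]_x (h x ^+ 2)%:E < +oo)%E ->
  m.-integrable setT (EFin \o (fun x => h x ^+ 2)).
Proof.
move=> mh hoo; apply/integrableP; split.
  by apply/measurable_EFinP; exact: measurable_funX.
by under eq_integral do rewrite /= ger0_norm ?sqr_ge0//.
Qed.

Lemma sqr_integrable d (T : measurableType d)
    (m : {measure set T -> \bar R}) (h : T -> R) (A : set T) : measurable A ->
  (m A < +oo)%E -> measurable_fun setT h ->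
  (forall x, ~ A x -> h x = 0) -> (\int[m]_x (h x ^+ 2)%:E < +oo)%E ->
  m.-integrable setT (EFin \o h).
Proof.
move=> mA Aoo mh h0 hoo.
have := integrableD measurableT (integrable_indic_fin mA Aoo)
  (integrable_sqr mh hoo).
apply: le_integrable => //; first exact/measurable_EFinP.
move=> x _ /=; rewrite lee_fin [leRHS]ger0_norm ?addr_ge0 ?sqr_ge0//.
have [Ax|/h0 ->] := pselect (A x); last by rewrite normr0 addr_ge0 ?sqr_ge0.
rewrite indicE mem_set//= -real_normK ?num_real//.
(* The square gives [|h| <= h^2 + 1/4], hence the bound by [1 + h^2] on [A]. *)
have := sqr_ge0 (`|h x| - 1/2); have := normr_ge0 (h x); nra.
Qed.

(* The Cauchy-Schwarz inequality against the indicator of [0,1], from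
   [0 <= \int (h - c)^2] with [c = \int h]. *)
Lemma sqr_integral_le (h : X -> R) : measurable_fun setT h ->
  (forall t, ~ I t -> h t = 0) ->
  (((\int[mu]_t h t) ^+ 2)%:E <= \int[mu]_t (h t ^+ 2)%:E)%E.
Proof.
move=> mh h0.
have [hoo|] := ltP (\int[mu]_t (h t ^+ 2)%:E)%E +oo%E; last first.
  by rewrite leye_eq => /eqP ->; rewrite leey.
have mI := measurable_unit_interval.
have Ioo : (mu I < +oo)%E by rewrite lebesgue_unit_interval ltry.
have int1 := integrable_indic_fin mI Ioo.
have inth := sqr_integrable mI Ioo mh h0 hoo.
have int2 := integrable_sqr mh hoo.
have -> : (\int[mu]_t (h t ^+ 2)%:E = (\int[mu]_t (h t ^+ 2))%:E)%E.
  by rewrite /Rintegral fineK//; exact: (integrable_fin_num measurableT int2).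
rewrite lee_fin; set c := \int[mu]_t h t.
have intI : \int[mu]_t (\1_I t) = 1 :> R.
  by rewrite /Rintegral integral_indic// setIT [X in fine X]lebesgue_unit_interval.
have Zl k (f : X -> R) : mu.-integrable setT (EFin \o f) ->
    mu.-integrable setT (EFin \o (fun t => k * f t)).
  by move=> /(integrableZl measurableT k).
have : 0 <= \int[mu]_t (h t - c * \1_I t) ^+ 2.
  by apply: Rintegral_ge0 => t _; exact: sqr_ge0.
have -> : \int[mu]_t (h t - c * \1_I t) ^+ 2 =
    \int[mu]_t (h t ^+ 2 + (- (2 * c) * h t + c ^+ 2 * \1_I t)).
  apply: eq_Rintegral => t _.
  have [It|nIt] := pselect (I t).
    by rewrite indicE mem_set//=; ring.
  by rewrite h0// indicE memNset//=; ring.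
have int3 := Zl (- (2 * c)) _ inth; have int4 := Zl (c ^+ 2) _ int1.
rewrite RintegralD//; last exact: (integrableD measurableT int3 int4).
rewrite RintegralD// RintegralZl// RintegralZl// intI -/c.
by nra.
Qed.

(** These are the real components of [L^2] functions. Being zero off the square, they can be
    integrated over the whole plane. *)
Definition sqint (g : R * R -> R) := [/\ measurable_fun (setT : set (X * X)) g,
  forall z, ~ Q z -> g z = 0 & (\int[mu2]_z (g z ^+ 2)%:E < +oo)%E].

Lemma sqint_integrable g : sqint g -> mu2.-integrable setT (EFin \o g).
Proof.
move=> [mg g0 goo]; apply: (sqr_integrable measurable_unit_square) => //.
by rewrite -[X in (X < _)%E]/(mu2 Q) lebesgue_unit_square ltry.
Qed.

Lemma sqint_sqr g : sqint g -> mu2.-integrable setT (EFin \o (fun z => g z ^+ 2)).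
Proof. by move=> [mg g0 goo]; exact: integrable_sqr. Qed.

Lemma sqint_mul u v : sqint u -> sqint v ->
  mu2.-integrable setT (EFin \o (fun z => u z * v z)).
Proof.
move=> su sv; have [mu' _ _] := su; have [mv _ _] := sv.
have := integrableD measurableT (sqint_sqr su) (sqint_sqr sv).
apply: le_integrable => //; first exact/measurable_EFinP/measurable_funM.
move=> z _ /=; rewrite lee_fin [leRHS]ger0_norm ?addr_ge0 ?sqr_ge0// normrM.
rewrite -(real_normK (num_real (u z))) -(real_normK (num_real (v z))).
have := sqr_ge0 (`|u z| - `|v z|); have := normr_ge0 (u z).
have := normr_ge0 (v z); nra.
Qed.

Lemma sqint_dom (g u : R * R -> R) :
  measurable_fun (setT : set (X * X)) g -> sqint u ->
  (forall z, `|g z| <= `|u z|) -> sqint g.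
Proof.
move=> mg [mu' u0 uoo] gu; split => //.
  by move=> z /u0 uz; move: (gu z); rewrite uz normr0 normr_le0 => /eqP.
have m2 f : measurable_fun (setT : set (X * X)) (f : R * R -> R) ->
    measurable_fun (setT : set (X * X)) (fun z => (f z ^+ 2)%:E).
  by move=> mf; apply/measurable_EFinP; exact: measurable_funX.
apply: le_lt_trans uoo; apply: ge0_le_integral => //; [|exact: m2|exact: m2|].
  by move=> z _; rewrite lee_fin sqr_ge0.
move=> z _; rewrite lee_fin -(real_normK (num_real (g z))).
by rewrite -(real_normK (num_real (u z))) lerXn2r// ?nnegrE.
Qed.

Lemma sqintZD c u v : sqint u -> sqint v -> sqint (fun z => c * u z + v z).
Proof.
move=> su sv; have [mu' u0 _] := su; have [mv v0 _] := sv; split.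
- by apply: measurable_funD => //; exact: measurable_funM.
- by move=> z nQ; rewrite u0// v0// mulr0 addr0.
have Zl k f : mu2.-integrable setT (EFin \o f) ->
    mu2.-integrable setT (EFin \o (fun t => k * f t)).
  by move=> /(integrableZl measurableT k).
have := integrableD measurableT (Zl (c ^+ 2 * 2) _ (sqint_sqr su))
  (Zl 2 _ (sqint_sqr sv)).
move=> /integrableP[_]; apply: le_lt_trans; apply: ge0_le_integral => //.
- by move=> z _; rewrite lee_fin sqr_ge0.
- apply/measurable_EFinP; apply: measurable_funX.
  by apply: measurable_funD => //; apply: measurable_funM.
- apply: measurableT_comp => //; apply/measurable_EFinP.
  by apply: measurable_funD; apply: measurable_funM => //; exact: measurable_funX.
move=> z _ /=; rewrite lee_fin ger0_norm; last first.
  by apply: addr_ge0; rewrite mulr_ge0 ?sqr_ge0// mulr_ge0 ?sqr_ge0.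
(* This is [(c u + v)^2 <= 2 c^2 u^2 + 2 v^2]. *)
by have := sqr_ge0 (c * u z - v z); nra.
Qed.

End SquareIntegrable.

(** * The operator on real functions *)

Section RealOperator.
Variable R : realType.
Local Notation X := (measurableTypeR R).
Local Notation mu := (@lebesgue_measure R).
Local Notation mu2 := (mu \x mu)%E.
Local Notation I := (@unit_interval R).
Local Notation Q := (@unit_square R).
Implicit Types (g u v : R * R -> R) (x y : R).

(** In the notation of the overview, [b] is [coltot f] and [a] is [coltot (lower f)]. The row
    integrals play the same role after reflection. *)
Definition coltot g x : R := \int[mu]_t g (t, x).
Definition rowtot g x : R := \int[mu]_y g (x, y).
Definition lower g : R * R -> R := fun z => g z * (z.2 < z.1)%R%:R.
(** The inner integral runs over the whole line because [g] is meant to vanish off the square; the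
    restriction to [Q] gives the result the same property. *)
Definition realT g : R * R -> R :=
  (fun z => \int[mu]_t (chi t z.1 z.2 * g (t, z.1))) \_ Q.

Lemma measurable_lt_pair : measurable_fun (setT : set (X * X))
  (fun z : X * X => (z.2 < z.1)%R%:R : R).
Proof.
apply: measurable_natr_bool; apply: measurable_fun_ltr;
  [exact: measurable_snd|exact: measurable_fst].
Qed.

Lemma sqint_lower g : sqint g -> sqint (lower g).
Proof.
move=> sg; have [mg _ _] := sg; apply: sqint_dom sg _ => [|z].
  by apply: measurable_funM => //; exact: measurable_lt_pair.
by rewrite /lower; case: (_ < _); rewrite ?mulr1// mulr0 normr0.
Qed.

Lemma measurable_col g x : measurable_fun (setT : set (X * X)) g ->
  measurable_fun (setT : set X) (fun t : X => g (t, x)).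
Proof. by move=> mg; exact: (measurable_fun_pair1 (f := g)). Qed.

Lemma measurable_chi x y : measurable_fun (setT : set X) (fun t : X => chi t x y).
Proof.
by apply: measurable_fun_ifT => //; last apply: measurable_fun_ifT => //;
  apply: measurable_and => //; apply: measurable_fun_ltr.
Qed.

Lemma integrable_colE g x y : mu.-integrable setT (EFin \o (fun t => g (t, x))) ->
  measurable_fun (setT : set (X * X)) g -> y != x ->
  \int[mu]_t (chi t x y * g (t, x)) =
    coltot (lower g) x + (y < x)%R%:R * coltot g x.
Proof.
move=> intg mg yx.
have mcol := measurable_col x mg.
have mlow : measurable_fun (setT : set X) (fun t : X => lower g (t, x)).
  apply: measurable_funM => //=; apply: measurable_natr_bool.
  by apply: measurable_fun_ltr => /=.
have intl : mu.-integrable setT (EFin \o (fun t => lower g (t, x))).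
  apply: le_integrable intg => //; first exact/measurable_EFinP.
  move=> t _; rewrite lee_fin /lower/=.
  by case: (_ < _); rewrite ?mulr1// mulr0 normr0.
transitivity (\int[mu]_t (lower g (t, x) + (y < x)%R%:R * g (t, x))).
  congr fine; apply: ae_eq_integral => //.
  - by apply/measurable_EFinP; apply: measurable_funM => //; exact: measurable_chi.
  - by apply/measurable_EFinP; apply: measurable_funD => //; exact: measurable_funM.
  (* With [y != x] given, [t = x] is the only point where the splitting of [chi] into two indicators
     may fail. *)
  exists [set x]; split => //; first exact: lebesgue_measure_set1.
  move=> t /= H; apply: contrapT => /eqP tx; apply: H => _.
  rewrite /chi /lower/=; congr EFin.
  case: (ltgtP t x) tx => // _ _; case: (ltgtP x y) yx => //= _ _; ring.
rewrite RintegralD// ?RintegralZl//.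
exact: (integrableZl measurableT (y < x)%R%:R intg).
Qed.

(** Each section of the diagonal is a point. Writing the diagonal as the zero set of [z.1 - z.2]
    makes it measurable. *)
Lemma diagonal_null : {ae mu2, forall z, z.2 != z.1}.
Proof.
pose N : set (X * X) := [set z | z.1 - z.2 = 0].
have mN : measurable N.
  have mB : measurable_fun setT (fun z : X * X => z.1 - z.2 : X).
    by apply: measurable_funB; [exact: measurable_fst|exact: measurable_snd].
  by rewrite -[N]setTI; apply: (mB measurableT [set 0]).
have : {ae mu2, forall z, ~ N z}.
  apply: ae_product_sections => //; apply: aeW => x.
  have -> : xsection N x = [set x].
    apply/seteqP; split => y; rewrite /xsection/= inE /N/=.
      by move=> /eqP; rewrite subr_eq0 => /eqP ->.
    by move=> ->; rewrite subrr.
  exact: lebesgue_measure_set1.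
apply: filterS => z; apply: contra_notN => /eqP /= zz.
by rewrite /N/= zz subrr.
Qed.

(** Two null sets are discarded: the diagonal, and the points whose first coordinate [x] has a
    non-integrable column. *)
Lemma realT_ae g : sqint g -> {ae mu2, forall z, Q z ->
  realT g z = coltot (lower g) z.1 + (z.2 < z.1)%R%:R * coltot g z.1}.
Proof.
move=> sg; have [mg _ _] := sg.
have := ae_integrable2 (sqint_integrable sg) => /ae_product_fst.
move/(_ _ _ mu); apply: filterS2 diagonal_null => -[x y] /= yx intx Qxy.
by rewrite /realT patchE mem_set//= integrable_colE.
Qed.

Lemma measurable_realT g : measurable_fun (setT : set (X * X)) g ->
  measurable_fun (setT : set (X * X)) (realT g).
Proof.
move=> mg; have mQ := @measurable_unit_square R.
rewrite /realT; apply/(measurable_restrictT _ mQ).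
apply: measurable_funTS; apply: measurableT_comp => //.
(* The parameters [(x, y)] form the first factor and the integration variable the second, so the
   operator is a section integral on a product. *)
pose F (w : (X * X) * X) := (chi w.2 w.1.1 w.1.2 * g (w.2, w.1.1))%:E.
have mp1 : measurable_fun setT (fun w : (X * X) * X => w.1.1).
  exact: measurableT_comp.
have mp2 : measurable_fun setT (fun w : (X * X) * X => w.1.2).
  exact: measurableT_comp.
have mp3 : measurable_fun setT (fun w : (X * X) * X => w.2).
  exact: measurable_snd.
apply: (@measurable_integral_section _ _ _ _ _ mu F).
apply/measurable_EFinP; apply: measurable_funM.
  by apply: measurable_fun_ifT => //; last apply: measurable_fun_ifT => //;
  apply: measurable_and => //; apply: measurable_fun_ltr.
apply: (measurableT_comp mg).
exact: measurable_fun_pair.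
Qed.

Lemma chi_sqr_le (t x y : R) : (chi t x y) ^+ 2 <= 4.
Proof. by rewrite /chi; case: ifP => _; [|case: ifP => _]; lra. Qed.

(** Cauchy-Schwarz on the column, with [chi^2 <= 4]. The bound depends on [z.2] only through an
    indicator of mass 1, so it can be integrated over the plane. *)
Lemma realT_sqr_le g z : measurable_fun (setT : set (X * X)) g ->
  (forall z, ~ Q z -> g z = 0) ->
  (((realT g z) ^+ 2)%:E <=
   4%:E * (\int[mu]_t (g (t, z.1) ^+ 2)%:E) * (\1_I z.2)%:E)%E.
Proof.
move=> mg g0; have mcol := measurable_col z.1 mg.
have mg2 : measurable_fun (setT : set X) (fun t : X => (g (t, z.1) ^+ 2)%:E).
  by apply/measurable_EFinP; exact: measurable_funX.
have g20 t : (0 <= (g (t, z.1) ^+ 2)%:E)%E by rewrite lee_fin sqr_ge0.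
rewrite /realT patchE; case: ifPn => [/set_mem Qz|_]; last first.
  rewrite expr0n; apply: mule_ge0; last by rewrite lee_fin.
  by apply: mule_ge0; [rewrite lee_fin|exact: integral_ge0].
rewrite indicE mem_set ?mule1; last by case: Qz.
apply: (le_trans (@sqr_integral_le R (fun t => chi t z.1 z.2 * g (t, z.1)) _ _)).
- by apply: measurable_funM => //; exact: measurable_chi.
- by move=> t It; rewrite g0 ?mulr0// => -[].
rewrite -ge0_integralZl//; apply: ge0_le_integral => //.
- by move=> t _; rewrite lee_fin sqr_ge0.
- apply/measurable_EFinP; apply: measurable_funX.
  by apply: measurable_funM => //; exact: measurable_chi.
- by apply/measurable_EFinP; apply: measurable_funM => //; exact: measurable_funX.
move=> t _; rewrite -EFinM lee_fin exprMn.
by rewrite ler_wpM2r ?sqr_ge0 ?chi_sqr_le.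
Qed.

(** The pointwise bound is integrated: the second variable contributes a factor 1, and Tonelli
    reassembles the columns into the square norm of [g]. *)
Lemma realT_norm_le g : sqint g ->
  (\int[mu2]_z (realT g z ^+ 2)%:E <= 4%:E * \int[mu2]_z (g z ^+ 2)%:E)%E.
Proof.
move=> [mg g0 goo].
pose h z : \bar R := (g z ^+ 2)%:E.
have h0 z : (0 <= h z)%E by rewrite lee_fin sqr_ge0.
have mh : measurable_fun (setT : set (X * X)) h.
  by apply/measurable_EFinP; exact: measurable_funX.
pose G x : \bar R := (\int[mu]_t h (t, x))%E.
have G0 x : (0 <= G x)%E by exact: integral_ge0.
have mG : measurable_fun (setT : set X) G.
  exact: (measurable_fun_fubini_tonelli_G (m1 := mu) h mh h0).
have m4G : measurable_fun (setT : set X) (fun x => 4%:E * G x)%E.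
  exact: measurable_funeM.
have m1 : measurable_fun (setT : set X) (fun y => (\1_I y)%:E : \bar R).
  apply/measurable_EFinP; exact: measurable_indic (@measurable_unit_interval R).
pose H (z : X * X) : \bar R := (4%:E * G z.1 * (\1_I z.2)%:E)%E.
have mH : measurable_fun setT H.
  apply: emeasurable_funM; first exact: (measurableT_comp m4G measurable_fst).
  exact: (measurableT_comp m1 measurable_snd).
have H0 z : (0 <= H z)%E.
  by apply: mule_ge0; [exact: mule_ge0|rewrite lee_fin].
apply: (@le_trans _ _ (\int[mu2]_z H z)%E).
  apply: ge0_le_integral => //.
  - by move=> z _; rewrite lee_fin sqr_ge0.
  - by apply/measurable_EFinP; apply: measurable_funX; exact: measurable_realT.
  - by move=> z _; exact: realT_sqr_le.
have -> : (\int[mu2]_z (g z ^+ 2)%:E = \int[mu]_x G x)%E.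
  exact: (fubini_tonelli2 (m1 := mu) (m2 := mu) h mh h0).
rewrite (fubini_tonelli1 H)//.
rewrite -ge0_integralZl//; apply: ge0_le_integral => //.
- by move=> x _; exact: integral_ge0.
- exact: (measurable_fun_fubini_tonelli_F (m2 := mu) H mH H0).
move=> x _; rewrite /fubini_F /H/= ge0_integralZl//; last exact: mule_ge0.
have mI := @measurable_unit_interval R; rewrite integral_indic// setIT.
by rewrite [X in (_ * X <= _)%E]lebesgue_unit_interval mule1.
Qed.

Lemma sqint_realT g : sqint g -> sqint (realT g).
Proof.
move=> sg; have [mg g0 goo] := sg; split; first exact: measurable_realT.
  by move=> z nQz; rewrite /realT patchE memNset.
by apply: le_lt_trans (realT_norm_le sg) _; rewrite lte_mul_pinfty.
Qed.

End RealOperator.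

(** * The reflection and the adjoint *)

Section Adjoint.
Variable R : realType.
Local Notation X := (measurableTypeR R).
Local Notation mu := (@lebesgue_measure R).
Local Notation mu2 := (mu \x mu)%E.
Local Notation I := (@unit_interval R).
Local Notation Q := (@unit_square R).
Implicit Types (g h u v : R * R -> R) (x y : R).

(** The column index is the second variable of [g] but the first one of [realT g]: [ae_product2]
    yields almost every column, and [ae_product_fst] lifts this back to the plane. *)
Lemma realT_eq_ae g h : measurable_fun (setT : set (X * X)) g ->
  measurable_fun (setT : set (X * X)) h ->
  {ae mu2, forall z, g z = h z} -> {ae mu2, forall z, realT g z = realT h z}.
Proof.
move=> mg mh /ae_product2/ae_product_fst gh; move: (gh _ _ mu).
apply: filterS => -[x y] /= {}gh; rewrite /realT !patchE.
case: ifP => // _; congr fine; apply: ae_eq_integral => //=.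
- apply/measurable_EFinP; apply: measurable_funM; first exact: measurable_chi.
  exact: measurable_col.
- apply/measurable_EFinP; apply: measurable_funM; first exact: measurable_chi.
  exact: measurable_col.
by apply: filterS gh => t /= -> _.
Qed.

(** Additivity of the real integral requires integrable columns, available only for almost every
    [x]. *)
Lemma realTZD_ae c g h : sqint g -> sqint h ->
  {ae mu2, forall z, realT (fun z => c * g z + h z) z = c * realT g z + realT h z}.
Proof.
move=> sg sh; have [mg _ _] := sg; have [mh _ _] := sh.
have /ae_product_fst ih := ae_integrable2 (sqint_integrable sh).
have /ae_product_fst ig := ae_integrable2 (sqint_integrable sg).
apply: filterS2 (ig _ _ mu) (ih _ _ mu) => -[x y] /= intg inth.
rewrite /realT !patchE.
case: ifP => _; last by rewrite mulr0 addr0.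
have intchi f : measurable_fun (setT : set (X * X)) f ->
    mu.-integrable setT (EFin \o (fun t => f (t, x))) ->
    mu.-integrable setT (EFin \o (fun t => chi t x y * f (t, x))).
  move=> mf /(integrableZl measurableT 2); apply: le_integrable => //.
    apply/measurable_EFinP; apply: measurable_funM; first exact: measurable_chi.
    exact: measurable_col.
  move=> t _ /=; rewrite lee_fin !normrM ler_wpM2r//.
  by rewrite /chi; case: ifP => _; [|case: ifP => _];
    rewrite ?normr0 ?normr1 // ?ger0_norm//; lra.
have {}intg := intchi _ mg intg; have {}inth := intchi _ mh inth.
rewrite /= -RintegralZl// -RintegralD//.
  by apply: eq_Rintegral => t _; ring.
exact: (integrableZl measurableT c intg).
Qed.

Definition flip (z : R * R) : R * R := (1 - z.2, 1 - z.1).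

Lemma flipK : involutive flip.
Proof. by move=> [x y]; rewrite /flip/= !subKr. Qed.

Lemma measurable_subl : measurable_fun (setT : set X) (fun x : X => 1 - x : X).
Proof. exact: measurable_funB. Qed.

Lemma measurable_flip :
  measurable_fun (setT : set (X * X)) (flip : X * X -> X * X).
Proof.
apply: measurable_fun_pair; first exact: (measurableT_comp measurable_subl).
exact: (measurableT_comp measurable_subl).
Qed.

Lemma unit_square_flip z : Q (flip z) <-> Q z.
Proof.
have H (x : R) : I (1 - x) <-> I x.
  by rewrite /unit_interval/= !in_itv/=; split=> /andP[? ?]; apply/andP; split; lra.
by case: z => x y; split=> -[/= /H ? /H ?].
Qed.

Lemma lebesgue_measure_subl (A : set X) : measurable A ->
  mu ((fun x : X => 1 - x) @^-1` A) = mu A.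
Proof.
have mrefl := measurable_subl.
pose f : {mfun X >-> X} := HB.pack (fun x : X => 1 - x : X)
  (isMeasurableFun.Build _ _ _ _ _ mrefl).
move=> mA; rewrite -[LHS]/(pushforward mu f A); apply/esym.
apply: lebesgue_measure_unique => // _ [[a b]] _ <-.
(* The reflection turns the generating interval []a, b]] into [[1 - b, 1 - a[], of the same
   length. *)
transitivity (mu `[1 - b, 1 - a[).
  rewrite !lebesgue_measure_itv/= !lte_fin ltrD2l ltrN2 -!EFinB.
  by congr (if _ then _%:E else _); ring.
congr (mu _); apply/seteqP; split => x /=; rewrite !in_itv/= => /andP[? ?];
  by apply/andP; split; lra.
Qed.

(** It suffices to test rectangles. The reflection also exchanges their sides, which is harmless
    because both factors carry the same measure. *)
Lemma flip_preserving (A : set (X * X)) : measurable A ->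
  mu2 (flip @^-1` A) = mu2 A.
Proof.
have mflip := measurable_flip.
pose f : {mfun (X * X)%type >-> (X * X)%type} := HB.pack (flip : X * X -> X * X)
  (isMeasurableFun.Build _ _ _ _ _ mflip).
move=> mA; rewrite -[LHS]/(pushforward mu2 f A); apply/esym.
apply: (product_measure_unique (m' := pushforward mu2 f)) => // B C mB mC.
pose r (x : X) : X := 1 - x.
have mpre (D : set X) : measurable D -> measurable (r @^-1` D).
  by move=> mD; rewrite -[_ @^-1` _]setTI; exact: measurable_subl.
transitivity (mu2 ((r @^-1` C) `*` (r @^-1` B))).
  by congr (mu2 _); apply/seteqP; split => -[x y] [].
transitivity (mu (r @^-1` C) * mu (r @^-1` B))%E.
  by apply: product_measure1E; exact: mpre.
by rewrite !lebesgue_measure_subl// muleC.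
Qed.

Lemma Rintegral_subl (f : R -> R) : measurable_fun (setT : set X) f ->
  \int[mu]_t f (1 - t) = \int[mu]_t f t.
Proof.
move=> mf; congr fine.
apply: (integral_preserving measurable_subl lebesgue_measure_subl measurableT).
exact/measurable_EFinP.
Qed.

Lemma Rintegral_flip g : measurable_fun (setT : set (X * X)) g ->
  \int[mu2]_z g (flip z) = \int[mu2]_z g z.
Proof.
move=> mg; congr fine.
apply: (integral_preserving measurable_flip flip_preserving measurableT).
exact/measurable_EFinP.
Qed.

Lemma sqint_flip g : sqint g -> sqint (g \o flip).
Proof.
move=> [mg g0 goo]; split.
- exact: (measurableT_comp mg measurable_flip).
- by move=> z nQz; rewrite /= g0// => /unit_square_flip.
have mg2 : measurable_fun (setT : set (X * X)) (fun z => (g z ^+ 2)%:E).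
  by apply/measurable_EFinP; exact: measurable_funX.
by rewrite -(integral_preserving measurable_flip flip_preserving measurableT mg2)
  in goo.
Qed.

Definition dot u v : R := \int[mu2]_z (u z * v z).

Lemma dotC u v : dot u v = dot v u.
Proof. by apply: eq_Rintegral => z _; rewrite mulrC. Qed.

Lemma dot_flip u v : sqint u -> sqint v -> dot (u \o flip) v = dot u (v \o flip).
Proof.
move=> [mu' _ _] [mv _ _]; rewrite /dot -[RHS]Rintegral_flip.
  by apply: eq_Rintegral => z _ /=; rewrite flipK.
apply: measurable_funM => //; exact: (measurableT_comp mv measurable_flip).
Qed.

Lemma integrable_coltot u : sqint u -> mu.-integrable setT (EFin \o coltot u).
Proof. by move=> /sqint_integrable; exact: integrable_Rmarginal2. Qed.

Lemma integrable_rowtot u : sqint u -> mu.-integrable setT (EFin \o rowtot u).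
Proof. by move=> /sqint_integrable; exact: integrable_Rmarginal1. Qed.

(** What remains of [realT u * v] at [x] once [y] is integrated out: the two coefficients of
    [realT u] do not depend on [y]. *)
Definition dot_density u v x :=
  coltot (lower u) x * rowtot v x + coltot u x * rowtot (lower v) x.

Lemma measurable_dot_density u v : sqint u -> sqint v ->
  measurable_fun (setT : set X) (dot_density u v).
Proof.
have mE (f : R -> R) : mu.-integrable setT (EFin \o f) ->
    measurable_fun (setT : set X) f by move=> /measurable_int/measurable_EFinP.
move=> su sv; have sul := sqint_lower su; have svl := sqint_lower sv.
apply: measurable_funD; apply: measurable_funM; apply: mE;
  by [exact: integrable_coltot|exact: integrable_rowtot].
Qed.

Lemma dot_realT u v : sqint u -> sqint v ->
  dot (realT u) v = \int[mu]_x dot_density u v x.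
Proof.
move=> su sv; have [mv v0 _] := sv; have [mTu _ _] := sqint_realT su.
have intTuv := sqint_mul (sqint_realT su) sv.
rewrite /dot -Rfubini1//; congr fine; apply: ae_eq_integral => //.
- exact: measurable_int (integrable_Rmarginal1 intTuv).
- by apply/measurable_EFinP; exact: measurable_dot_density.
have [mvl _ _] := sqint_lower sv.
have i1 := ae_integrable1 (sqint_integrable sv).
have i2 := ae_integrable1 (sqint_integrable (sqint_lower sv)).
have i3 := ae_product1 (realT_ae su).
apply: filterS3 i1 i2 i3 => x iv ivl Tu _; congr EFin.
transitivity (\int[mu]_y (coltot (lower u) x * v (x, y) +
    coltot u x * lower v (x, y))).
  congr fine; apply: ae_eq_integral => //.
  - apply/measurable_EFinP.
    by apply: (measurable_fun_pair2 (f := fun z : X * X => realT u z * v z));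
      exact: measurable_funM.
  - apply/measurable_EFinP; apply: measurable_funD; apply: measurable_funM => //.
      exact: (measurable_fun_pair2 (f := v)).
    exact: (measurable_fun_pair2 (f := lower v)).
  apply: filterS Tu => y Tu _; congr EFin.
  have [/Tu ->|/v0 vxy] := pselect (Q (x, y)); first by rewrite /lower/=; ring.
  by rewrite /lower vxy; ring.
have intZ k f : mu.-integrable setT (EFin \o f) ->
    mu.-integrable setT (EFin \o (fun t => k * f t)).
  by move=> /(integrableZl measurableT k).
rewrite RintegralD//; [|exact: intZ iv|exact: intZ ivl].
by rewrite !RintegralZl.
Qed.

Lemma coltot_flip u x : sqint u -> coltot (u \o flip) x = rowtot u (1 - x).
Proof.
move=> [mu' _ _]; rewrite /coltot /rowtot/=.
rewrite -[RHS]Rintegral_subl//.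
exact: (measurable_fun_pair2 (f := u)).
Qed.

Lemma rowtot_flip u x : sqint u -> rowtot (u \o flip) x = coltot u (1 - x).
Proof.
move=> [mu' _ _]; rewrite /coltot /rowtot/=.
by rewrite -[RHS]Rintegral_subl//; exact: measurable_col.
Qed.

(** The reflection reverses the order and exchanges the coordinates, so it maps the triangle below
    the diagonal to itself. *)
Lemma lower_flip u : lower (u \o flip) = lower u \o flip.
Proof. by apply/funext => z; rewrite /lower/= ltrD2l ltrN2. Qed.

(** Reflection turns column integrals into row integrals at [1 - x]. Hence the density of
    [(v \o flip, u \o flip)] at [x] is that of [(u, v)] at [1 - x], with its two summands
    exchanged. *)
Lemma dot_realT_flip u v : sqint u -> sqint v ->
  dot (realT u) v = dot u (realT (v \o flip) \o flip).
Proof.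
move=> su sv; have su' := sqint_flip su; have sv' := sqint_flip sv.
rewrite -dot_flip//; last exact: sqint_realT.
rewrite [RHS]dotC (dot_realT su sv) (dot_realT sv' su').
rewrite -[LHS]Rintegral_subl; last exact: measurable_dot_density.
apply: eq_Rintegral => x _; rewrite /dot_density.
have sul := sqint_lower su; have svl := sqint_lower sv.
rewrite !lower_flip !coltot_flip// !rowtot_flip//; ring.
Qed.

Lemma dotDl u v w : sqint u -> sqint v -> sqint w ->
  dot (fun z => u z + v z) w = dot u w + dot v w.
Proof.
move=> su sv sw; rewrite /dot -RintegralD//; try exact: sqint_mul.
by apply: eq_Rintegral => z _; rewrite mulrDl.
Qed.

Lemma dotZl c u w : sqint u -> sqint w -> dot (fun z => c * u z) w = c * dot u w.
Proof.
move=> su sw; rewrite /dot -RintegralZl//; last exact: sqint_mul.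
by apply: eq_Rintegral => z _; rewrite mulrA.
Qed.

Lemma eq_dot u u' v : sqint u -> sqint u' -> sqint v ->
  {ae mu2, forall z, u z = u' z} -> dot u v = dot u' v.
Proof.
move=> su su' sv uu'; congr fine; apply: ae_eq_integral => //.
- exact: measurable_int (sqint_mul su sv).
- exact: measurable_int (sqint_mul su' sv).
by apply: ae_impl uu' => z /= ->.
Qed.

Lemma dot_ge0 u : 0 <= dot u u.
Proof. by apply: Rintegral_ge0 => z _; rewrite -expr2 sqr_ge0. Qed.

Lemma dot_realT_le u : sqint u -> dot (realT u) (realT u) <= 4 * dot u u.
Proof.
have dotE v : dot v v = fine (\int[mu2]_z (v z ^+ 2)%:E)%E by [].
move=> su; have sT := sqint_realT su.
have fin v : sqint v -> (\int[mu2]_z (v z ^+ 2)%:E)%E \is a fin_num.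
  by move=> /sqint_sqr intv; exact: (integrable_fin_num measurableT intv).
rewrite !dotE -lee_fin EFinM !fineK ?fin//.
exact: realT_norm_le.
Qed.

End Adjoint.

(** * The differential system *)

Section DecayUniqueness.
Variable R : realType.
Implicit Types (u v f : R -> R) (x : R).

(* [|u + iv|^2 e^(2 p x)] is constant when [(u + iv)' = - (p + iq) (u + iv)]. *)
Lemma decay_unique u v (p q a b : R) :
  {within `[0, 1], continuous u} -> {within `[0, 1], continuous v} ->
  (forall x, 0 < x < 1 -> is_derive x 1 u (- (p * u x - q * v x))) ->
  (forall x, 0 < x < 1 -> is_derive x 1 v (- (p * v x + q * u x))) ->
  0 <= a <= 1 -> 0 <= b <= 1 -> u a = 0 -> v a = 0 -> u b = 0 /\ v b = 0.
Proof.
move=> cu cv du dv a01 b01 ua va.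
pose e : R -> R := expR \o ((2 * p) \*: id).
pose w : R -> R := (u * u + v * v) * e.
have de x : is_derive x 1 e (2 * p * e x).
  by apply: is_derive_eq; rewrite /e/= /GRing.scale/=; ring.
have dw x : 0 < x < 1 -> is_derive x 1 w 0.
  move=> x01; have {}du := du x x01; have {}dv := dv x x01; have {}de := de x.
  have := is_deriveM (is_deriveD (is_deriveM du du) (is_deriveM dv dv)) de.
  move=> /is_derive_eq; apply; rewrite /GRing.scale/= !fctE; ring.
have ce : {within `[0, 1], continuous e}.
  apply: continuous_subspaceT => x; apply: differentiable_continuous.
  by apply/derivable1_diffP; case: (de x).
have cw : {within `[0, 1], continuous w}.
  move=> x; apply: continuousM; last exact: ce.
  by apply: continuousD; apply: continuousM; by [exact: cu|exact: cv].
have wE x y : 0 <= x <= 1 -> 0 <= y <= 1 -> x <= y -> w x = w y.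
  move=> /andP[x0 x1] /andP[y0 y1] xy.
  have [z| |c _] := @MVT_segment R w (fun=> 0) x y xy.
  - by rewrite in_itv/= => /andP[xz zy]; apply: dw; apply/andP; split; lra.
  - apply: continuous_subspaceW cw => z /=; rewrite !in_itv/= => /andP[? ?].
    by apply/andP; split; lra.
  - by rewrite mul0r => /eqP; rewrite subr_eq0 => /eqP.
have wb : w b = 0.
  have wa : w a = 0 by rewrite /w !fctE ua va; ring.
  by have [ab|/ltW ab] := leP a b; [rewrite -(wE a b)|rewrite (wE b a)].
have : u b ^+ 2 + v b ^+ 2 = 0.
  move: wb; rewrite /w !fctE => /eqP.
  rewrite mulf_eq0 [e b == 0]gt_eqF ?orbF ?expR_gt0// => /eqP.
  by rewrite -!expr2.
by move=> uv; have := sqr_ge0 (u b); have := sqr_ge0 (v b); split; nra.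
Qed.

End DecayUniqueness.

(** * The integral system behind the eigenvalue equation *)

Section IntegralSystem.
Variable R : realType.
Local Notation X := (measurableTypeR R).
Local Notation mu := (@lebesgue_measure R).
Implicit Types (f g : R -> R) (x : R).
Local Notation integrable01 f := (mu.-integrable `[0, 1] (EFin \o f)).

Definition prim f x : R := \int[mu]_(t in `[0, x]) f t.

Lemma sub_itv01 x : x <= 1 -> `[0, x] `<=` (`[0, 1] : set R).
Proof. by move=> x1; apply: subset_itvl; rewrite bnd_simp. Qed.

Lemma Rintegral_tail f x : integrable01 f -> 0 <= x <= 1 ->
  \int[mu]_(t in `]x, 1]) f t = prim f 1 - prim f x.
Proof.
move=> intf /andP[x0 x1].
by rewrite /prim -(@Rintegral_itvB R f (BLeft 0) (BRight 1) x intf) ?bnd_simp.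
Qed.

Lemma prim0 f : prim f 0 = 0.
Proof. by rewrite /prim set_itv1 Rintegral_set1. Qed.

Lemma continuous_prim f : integrable01 f ->
  {within `[0, 1], continuous (prim f)}.
Proof. by move=> intf; exact: parameterized_integral_continuous. Qed.

Lemma is_derive_prim f x : {within `[0, 1], continuous f} -> 0 < x < 1 ->
  is_derive x 1 (prim f) (f x).
Proof.
move=> cf /andP[x0 x1].
have intf : integrable01 f.
  by apply: continuous_compact_integrable => //; exact: segment_compact.
have /(continuous_within_itvP _ ltr01)[cfo _ _] := cf.
have cfx : {for x, continuous f} by apply: cfo; rewrite in_itv/= x0 x1.
have [dx fx] := continuous_FTC1_closed x1 intf x0 cfx.
apply: DeriveDef; first exact: dx.
by rewrite -derive1E; exact: fx.
Qed.

(** This transfers differentiability to the primitive of a merely integrable function that agrees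
    almost everywhere with a continuous one. *)
Lemma prim_eq_ae f g x : integrable01 f -> integrable01 g ->
  {ae mu, forall t, 0 <= t <= 1 -> f t = g t} -> x <= 1 ->
  prim f x = prim g x.
Proof.
move=> /measurable_int mf /measurable_int mg fg x1; congr fine.
apply: ae_eq_integral => //.
- by apply: measurable_funS mf => //; exact: sub_itv01.
- by apply: measurable_funS mg => //; exact: sub_itv01.
apply: ae_impl fg => t fg /= /(sub_itv01 x1) t01.
by rewrite fg//; move: t01; rewrite /= in_itv.
Qed.

Lemma integrable_lin (c k : R) f g : integrable01 f -> integrable01 g ->
  integrable01 (fun t => c * f t + k * g t).
Proof.
move=> intf intg; have m01 : measurable (`[0, 1] : set X) by exact: measurable_itv.
exact: (integrableD m01 (integrableZl m01 c intf) (integrableZl m01 k intg)).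
Qed.

Lemma primD f g x : integrable01 f -> integrable01 g -> x <= 1 ->
  prim (fun t => f t + g t) x = prim f x + prim g x.
Proof.
move=> intf intg x1.
have mx : measurable (`[0, x] : set X) by exact: measurable_itv.
have m1 : measurable (`[0, 1] : set X) by exact: measurable_itv.
have {}intf := integrableS m1 mx (sub_itv01 x1) intf.
have {}intg := integrableS m1 mx (sub_itv01 x1) intg.
by rewrite /prim RintegralD.
Qed.

(* [a1 + i a2], [b1 + i b2] stand for [\int_x^1 f(t,x) dt], [\int_0^1 f(t,x) dt]
   and [p + iq] for the inverse [m] of the eigenvalue: the hypotheses read
   [a(x) = m \int_x^1 (a + b)] and [b(x) = m (\int_0^1 a + \int_x^1 b)].
   For continuous [a], [b] the function [d = a - m (1 - x) b] satisfies
   [d' = - m d] and [d(1) = 0], hence [d = 0]; as [a(0) = b(0)] this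
   gives [(1 - m) b(0) = 0]. *)
Lemma eigen_system (p q : R) (a1 a2 b1 b2 : R -> R) :
  integrable01 a1 -> integrable01 a2 -> integrable01 b1 -> integrable01 b2 ->
  let A1 x := p * a1 x - q * a2 x in let A2 x := p * a2 x + q * a1 x in
  let B1 x := p * b1 x - q * b2 x in let B2 x := p * b2 x + q * b1 x in
  {ae mu, forall x, 0 <= x <= 1 ->
    [/\ a1 x = \int[mu]_(t in `]x, 1]) (A1 t + B1 t),
        a2 x = \int[mu]_(t in `]x, 1]) (A2 t + B2 t),
        b1 x = \int[mu]_(t in `[0, 1]) A1 t + \int[mu]_(t in `]x, 1]) B1 t &
        b2 x = \int[mu]_(t in `[0, 1]) A2 t + \int[mu]_(t in `]x, 1]) B2 t]} ->
  exists c : R * R, (c != (0, 0) -> p = 1 /\ q = 0) /\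
    {ae mu, forall x, 0 <= x <= 1 ->
      [/\ a1 x = (1 - x) * (c.1 * expR (- x)), a2 x = (1 - x) * (c.2 * expR (- x)),
          b1 x = c.1 * expR (- x) & b2 x = c.2 * expR (- x)]}.
Proof.
move=> ia1 ia2 ib1 ib2 A1 A2 B1 B2 sys.
have eL (s t : R) f g : (fun x => s * f x - t * g x) =
    (fun x => s * f x + (- t) * g x) :> (R -> R).
  by apply/funext => x; rewrite mulNr.
have e1 f g : (fun x => f x + g x) = (fun x => 1 * f x + 1 * g x) :> (R -> R).
  by apply/funext => x; rewrite !mul1r.
have iA1 : integrable01 A1 by rewrite /A1 eL; exact: integrable_lin.
have iA2 : integrable01 A2 by exact: integrable_lin.
have iB1 : integrable01 B1 by rewrite /B1 eL; exact: integrable_lin.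
have iB2 : integrable01 B2 by exact: integrable_lin.
(* [U1], [U2], [V1], [V2] are the right-hand sides of the system written with primitives: continuous
   representatives of [a1], [a2], [b1], [b2]. *)
pose U1 : R -> R := cst (prim A1 1 + prim B1 1) - prim A1 - prim B1.
pose U2 : R -> R := cst (prim A2 1 + prim B2 1) - prim A2 - prim B2.
pose V1 : R -> R := cst (prim A1 1 + prim B1 1) - prim B1.
pose V2 : R -> R := cst (prim A2 1 + prim B2 1) - prim B2.
have {}sys : {ae mu, forall x, 0 <= x <= 1 ->
    [/\ a1 x = U1 x, a2 x = U2 x, b1 x = V1 x & b2 x = V2 x]}.
  apply: ae_impl sys => x + x01 => /(_ x01)[-> -> -> ->]; have /andP[_ x1] := x01.
  have intD f g : integrable01 f -> integrable01 g -> integrable01 (fun x => f x + g x).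
    by move=> if_ ig; rewrite e1; exact: integrable_lin.
  rewrite !Rintegral_tail//; try exact: intD.
  rewrite !(primD iA1 iB1)// !(primD iA2 iB2)// /U1 /U2 /V1 /V2 -!/(prim _ 1) !fctE.
  by split; ring.
have cc (k : R) : {within `[0, 1], continuous (fun _ : R => k : R)}.
  by apply: continuous_subspaceT => x; exact: cst_continuous.
have cU1 : {within `[0, 1], continuous U1}.
  move=> x; apply: continuousB; last exact: continuous_prim.
  by apply: continuousB; [exact: cc|exact: continuous_prim].
have cU2 : {within `[0, 1], continuous U2}.
  move=> x; apply: continuousB; last exact: continuous_prim.
  by apply: continuousB; [exact: cc|exact: continuous_prim].
have cV1 : {within `[0, 1], continuous V1}.
  by move=> x; apply: continuousB; [exact: cc|exact: continuous_prim].
have cV2 : {within `[0, 1], continuous V2}.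
  by move=> x; apply: continuousB; [exact: cc|exact: continuous_prim].
have cL (s t : R) f g : {within `[0, 1], continuous f} ->
    {within `[0, 1], continuous g} ->
    {within `[0, 1], continuous (fun x => s * f x + t * g x)}.
  move=> cf cg; suff: {within `[0, 1], continuous (cst s * f + cst t * g)} by [].
  by move=> x; apply: continuousD; apply: continuousM;
    by [exact: cc|exact: cf|exact: cg].
have cZ (k : R) f : {within `[0, 1], continuous f} ->
    {within `[0, 1], continuous (k \*: f)}.
  move=> cf; suff: {within `[0, 1], continuous (cst k * f)} by [].
  by move=> x; apply: continuousM; [exact: cc|exact: cf].
have icont f : {within `[0, 1], continuous f} -> integrable01 f.
  by move=> cf; apply: continuous_compact_integrable => //; exact: segment_compact.
(* The primitive only sees the continuous representatives [F], [G], so the fundamental theorem of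
   calculus applies to them; the two primitives coincide near [x] because [x < 1]. *)
have dprim (s t : R) f g (F G : R -> R) : integrable01 f -> integrable01 g ->
    {within `[0, 1], continuous F} -> {within `[0, 1], continuous G} ->
    {ae mu, forall x, 0 <= x <= 1 -> f x = F x /\ g x = G x} ->
    forall x, 0 < x < 1 ->
    is_derive x 1 (prim (fun x => s * f x + t * g x)) (s * F x + t * G x).
  move=> if_ ig cF cG fg x x01.
  have dP := is_derive_prim (cL s t _ _ cF cG) x01.
  have E y : y <= 1 -> prim (fun x => s * f x + t * g x) y =
      prim (fun x => s * F x + t * G x) y.
    apply: prim_eq_ae; [exact: integrable_lin|exact: icont (cL _ _ _ _ _ _)|].
    by apply: ae_impl fg => z fg z01; have [-> ->] := fg z01.
  apply: near_eq_is_derive dP; have /andP[_ x1] := x01; near=> y; apply/esym/E/ltW.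
  near: y; exact: lt_nbhsl.
have dA1 x : 0 < x < 1 -> is_derive x 1 (prim A1) (p * U1 x - q * U2 x).
  move=> x01; rewrite /A1 eL -mulNr; apply: dprim => //.
  by apply: ae_impl sys => z + z01 => /(_ z01)[].
have dA2 x : 0 < x < 1 -> is_derive x 1 (prim A2) (p * U2 x + q * U1 x).
  move=> x01; apply: dprim => //.
  by apply: ae_impl sys => z + z01 => /(_ z01)[].
have dB1 x : 0 < x < 1 -> is_derive x 1 (prim B1) (p * V1 x - q * V2 x).
  move=> x01; rewrite /B1 eL -mulNr; apply: dprim => //.
  by apply: ae_impl sys => z + z01 => /(_ z01)[].
have dB2 x : 0 < x < 1 -> is_derive x 1 (prim B2) (p * V2 x + q * V1 x).
  move=> x01; apply: dprim => //.
  by apply: ae_impl sys => z + z01 => /(_ z01)[].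
have dV1 x : 0 < x < 1 -> is_derive x 1 V1 (- (p * V1 x - q * V2 x)).
  move=> x01; have {}dB1 := dB1 x x01.
    have := is_deriveB (is_derive_cst (prim A1 1 + prim B1 1) x 1) dB1.
  by move=> /is_derive_eq; apply; rewrite sub0r.
have dV2 x : 0 < x < 1 -> is_derive x 1 V2 (- (p * V2 x + q * V1 x)).
  move=> x01; have {}dB2 := dB2 x x01.
    have := is_deriveB (is_derive_cst (prim A2 1 + prim B2 1) x 1) dB2.
  by move=> /is_derive_eq; apply; rewrite sub0r.
(* Real and imaginary parts of [d], with [U1] and [U2] spelled out so that the derivative rules
   apply to the expression as written. *)
pose D1 : R -> R := cst (prim A1 1 + prim B1 1) - prim A1 - prim B1 -
  (cst 1 - id) * (p \*: V1 - q \*: V2).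
pose D2 : R -> R := cst (prim A2 1 + prim B2 1) - prim A2 - prim B2 -
  (cst 1 - id) * (p \*: V2 + q \*: V1).
have D1E x : D1 x = U1 x - (1 - x) * (p * V1 x - q * V2 x) by [].
have D2E x : D2 x = U2 x - (1 - x) * (p * V2 x + q * V1 x) by [].
have did x : is_derive x 1 (cst 1 - id : R -> R) (0 - 1).
  exact: is_deriveB.
have dD1 x : 0 < x < 1 -> is_derive x 1 D1 (- (p * D1 x - q * D2 x)).
  move=> x01; have {}dA1 := dA1 x x01; have {}dB1 := dB1 x x01.
  have := is_deriveB (is_deriveB (is_deriveB
    (is_derive_cst (prim A1 1 + prim B1 1) x 1) dA1) dB1) (is_deriveM (did x)
    (is_deriveB (is_deriveZ p (dV1 x x01)) (is_deriveZ q (dV2 x x01)))).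
  by move=> /is_derive_eq; apply; rewrite D1E D2E !fctE/= /GRing.scale/=; ring.
have dD2 x : 0 < x < 1 -> is_derive x 1 D2 (- (p * D2 x + q * D1 x)).
  move=> x01; have {}dA2 := dA2 x x01; have {}dB2 := dB2 x x01.
  have := is_deriveB (is_deriveB (is_deriveB
    (is_derive_cst (prim A2 1 + prim B2 1) x 1) dA2) dB2) (is_deriveM (did x)
    (is_deriveD (is_deriveZ p (dV2 x x01)) (is_deriveZ q (dV1 x x01)))).
  by move=> /is_derive_eq; apply; rewrite D1E D2E !fctE/= /GRing.scale/=; ring.
have cid : {within `[0, 1], continuous (cst 1 - id : R -> R)}.
  by apply: continuous_subspaceT => x; apply: continuousB;
    [exact: cst_continuous|exact: id].
have cD1 : {within `[0, 1], continuous D1}.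
  move=> x; apply: continuousB; first exact: cU1.
  apply: continuousM; first exact: cid.
  by apply: continuousB; [exact: (cZ p V1)|exact: (cZ q V2)].
have cD2 : {within `[0, 1], continuous D2}.
  move=> x; apply: continuousB; first exact: cU2.
  apply: continuousM; first exact: cid.
  by apply: continuousD; [exact: (cZ p V2)|exact: (cZ q V1)].
have i00 : 0 <= (0 : R) <= 1 by rewrite lexx ler01.
have i11 : 0 <= (1 : R) <= 1 by rewrite lexx ler01.
have D11 : D1 1 = 0 by rewrite D1E /U1 !fctE; ring.
have D21 : D2 1 = 0 by rewrite D2E /U2 !fctE; ring.
(* Uniqueness is used backwards from the right endpoint, where [U1], [U2] and the factor [1 - x] all
   vanish. *)
have D0 x (x01 : 0 <= x <= 1) := decay_unique cD1 cD2 dD1 dD2 i11 x01 D11 D21.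
have [D10 D20] := D0 0 i00.
have UV1 : U1 0 = V1 0 by rewrite /U1 /V1 !fctE !prim0; ring.
have UV2 : U2 0 = V2 0 by rewrite /U2 /V2 !fctE !prim0; ring.
rewrite D1E UV1 subr0 mul1r in D10; rewrite D2E UV2 subr0 mul1r in D20.
exists (V1 0, V2 0).
have pq : (V1 0, V2 0) != (0, 0) -> p = 1 /\ q = 0.
  move=> V0.
  have V2gt0 : 0 < V1 0 ^+ 2 + V2 0 ^+ 2.
    rewrite lt_neqAle addr_ge0 ?sqr_ge0// andbT eq_sym.
    rewrite paddr_eq0 ?sqr_ge0// !sqrf_eq0.
    by apply: contra V0 => /andP[/eqP -> /eqP ->].
  (* With [V = V1 0 + i V2 0], the vanishing of [d] at 0 reads [(1 - m) V = 0]. Multiplying by the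
     conjugate of [V] gives [E1] as real part and [E2] as minus the imaginary part. *)
  have E1 : (1 - p) * (V1 0 ^+ 2 + V2 0 ^+ 2) = 0.
    transitivity (V1 0 * (V1 0 - (p * V1 0 - q * V2 0)) +
      V2 0 * (V2 0 - (p * V2 0 + q * V1 0))); first by ring.
    by rewrite D10 D20 !mulr0 addr0.
  have E2 : q * (V1 0 ^+ 2 + V2 0 ^+ 2) = 0.
    transitivity (V2 0 * (V1 0 - (p * V1 0 - q * V2 0)) -
      V1 0 * (V2 0 - (p * V2 0 + q * V1 0))); first by ring.
    by rewrite D10 D20 !mulr0 subr0.
  move: E1 E2 => /eqP; rewrite mulf_eq0 (gt_eqF V2gt0) orbF subr_eq0.
  move=> /eqP <- /eqP; rewrite mulf_eq0 (gt_eqF V2gt0) orbF => /eqP.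
  by [].
split => //.
have VE x : 0 <= x <= 1 -> V1 x = V1 0 * expR (- x) /\ V2 x = V2 0 * expR (- x).
  move=> x01.
  (* If the initial value is zero, uniqueness applies at once. Otherwise [m = 1], and the difference
     between [V] and [V(0) e^(-x)] solves the same system with zero initial value. *)
  have [[V10 V20]|/pq[p1 q0]] := eqVneq (V1 0, V2 0) (0, 0).
    by rewrite V10 V20 !mul0r; exact: (decay_unique cV1 cV2 dV1 dV2 i00 x01).
  pose e : R -> R := expR \o (-1 \*: id).
  have eE (y : R) : e y = expR (- y) by rewrite /e/= /GRing.scale/= mulN1r.
  have de (y : R) : is_derive y 1 e (- e y).
    have := is_derive1_comp (is_derive_expR _) (is_deriveZ (-1) (is_derive_id y 1)).
    by move=> /is_derive_eq; apply; rewrite /e/= /GRing.scale/=; ring.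
  have ce : {within `[0, 1], continuous e}.
    apply: continuous_subspaceT => y; apply: differentiable_continuous.
    by apply/derivable1_diffP; case: (de y).
  pose W1 : R -> R := V1 - V1 0 \*: e; pose W2 : R -> R := V2 - V2 0 \*: e.
  have cW1 : {within `[0, 1], continuous W1}.
    move=> y; apply: continuousB; first exact: cV1.
    exact: (cZ _ e ce).
  have cW2 : {within `[0, 1], continuous W2}.
    move=> y; apply: continuousB; first exact: cV2.
    exact: (cZ _ e ce).
  have dW1 (y : R) : 0 < y < 1 -> is_derive y 1 W1 (- (1 * W1 y - 0 * W2 y)).
    move=> y01; have := is_deriveB (dV1 y y01) (is_deriveZ (V1 0) (de y)).
    by move=> /is_derive_eq; apply; rewrite /W1 !fctE/= /GRing.scale/= p1 q0; ring.
  have dW2 (y : R) : 0 < y < 1 -> is_derive y 1 W2 (- (1 * W2 y + 0 * W1 y)).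
    move=> y01; have := is_deriveB (dV2 y y01) (is_deriveZ (V2 0) (de y)).
    by move=> /is_derive_eq; apply; rewrite /W2 !fctE/= /GRing.scale/= p1 q0; ring.
  have W10 : W1 0 = 0 by rewrite /W1 !fctE/= /GRing.scale/= eE oppr0 expR0; ring.
  have W20 : W2 0 = 0 by rewrite /W2 !fctE/= /GRing.scale/= eE oppr0 expR0; ring.
  have [] := decay_unique cW1 cW2 dW1 dW2 i00 x01 W10 W20.
  rewrite /W1 /W2 !fctE/= /GRing.scale/= eE => /eqP + /eqP.
  by rewrite !subr_eq0 => /eqP -> /eqP ->.
apply: ae_impl sys => x sys x01; have [-> -> -> ->] := sys x01 => /=.
have [V1x V2x] := VE x x01; have [] := D0 x x01.
rewrite D1E D2E => /eqP + /eqP; rewrite !subr_eq0 => /eqP -> /eqP ->.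
have [[V10 V20]|/pq[-> ->]] := eqVneq (V1 0, V2 0) (0, 0).
  by rewrite V1x V2x V10 V20; split; ring.
by rewrite -V1x -V2x; split; ring.
Unshelve. all: by end_near. Qed.

End IntegralSystem.

(** * Complex functions and their components *)

Section Components.
Variable R : realType.
Local Notation X := (measurableTypeR R).
Local Notation mu := (@lebesgue_measure R).
Local Notation mu2 := (mu \x mu)%E.
Local Notation Q := (@unit_square R).
Local Notation C := R[i].
Implicit Types (f g : R * R -> C) (z : R * R).

Definition sqRe f : R * R -> R := (fun z => complex.Re (f z)) \_ Q.
Definition sqIm f : R * R -> R := (fun z => complex.Im (f z)) \_ Q.

Lemma sqReE f z : Q z -> sqRe f z = complex.Re (f z).
Proof. by move=> Qz; rewrite /sqRe patchE mem_set. Qed.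

Lemma sqImE f z : Q z -> sqIm f z = complex.Im (f z).
Proof. by move=> Qz; rewrite /sqIm patchE mem_set. Qed.

Lemma sqRe0 f z : ~ Q z -> sqRe f z = 0.
Proof. by move=> nQz; rewrite /sqRe patchE memNset. Qed.

Lemma sqIm0 f z : ~ Q z -> sqIm f z = 0.
Proof. by move=> nQz; rewrite /sqIm patchE memNset. Qed.

Lemma complex_ext (w1 w2 : C) : complex.Re w1 = complex.Re w2 ->
  complex.Im w1 = complex.Im w2 -> w1 = w2.
Proof. by case: w1 w2 => [a b] [c e] /= -> ->. Qed.

Lemma Re_mul (w1 w2 : C) : @complex.Re R (w1 * w2) =
  complex.Re w1 * complex.Re w2 - complex.Im w1 * complex.Im w2.
Proof. by case: w1 w2 => [a b] [c e]. Qed.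

Lemma Im_mul (w1 w2 : C) : @complex.Im R (w1 * w2) =
  complex.Re w1 * complex.Im w2 + complex.Im w1 * complex.Re w2.
Proof. by case: w1 w2 => [a b] [c e]. Qed.

Lemma Re_add (w1 w2 : C) : @complex.Re R (w1 + w2) = complex.Re w1 + complex.Re w2.
Proof. by case: w1 w2 => [a b] [c e]. Qed.

Lemma Im_add (w1 w2 : C) : @complex.Im R (w1 + w2) = complex.Im w1 + complex.Im w2.
Proof. by case: w1 w2 => [a b] [c e]. Qed.

(** The squared modulus is the sum of two nonnegative squares, so its integral is finite exactly
    when both component integrals are. *)
Lemma memL2P f : memL2 f <-> sqint (sqRe f) /\ sqint (sqIm f).
Proof.
have mQ := @measurable_unit_square R.
have m2 (h : R * R -> R) : measurable_fun (setT : set (X * X)) h ->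
    measurable_fun (setT : set (X * X)) (fun z => (h z ^+ 2)%:E).
  by move=> mh; apply/measurable_EFinP; exact: measurable_funX.
have sumE : measurable_fun (setT : set (X * X)) (sqRe f) ->
    measurable_fun (setT : set (X * X)) (sqIm f) ->
    (\int[@leb2 R]_(z in Q)
      (complex.Re (f z) ^+ 2 + complex.Im (f z) ^+ 2)%:E =
    \int[mu2]_z (sqRe f z ^+ 2)%:E + \int[mu2]_z (sqIm f z ^+ 2)%:E)%E.
  move=> mR mI; rewrite integral_mkcond -ge0_integralD//; last 4 first.
  - by move=> z _; rewrite lee_fin sqr_ge0.
  - exact: m2.
  - by move=> z _; rewrite lee_fin sqr_ge0.
  - exact: m2.
  apply: eq_integral => z _; rewrite patchE; case: ifPn => [/set_mem Qz|/negP nQ].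
    by rewrite sqReE// sqImE// EFinD.
  have nQz : ~ Q z by move=> Qz; apply: nQ; rewrite inE.
  by rewrite sqRe0// sqIm0// expr0n/= adde0.
have pos (h : R * R -> R) : (0 <= \int[mu2]_z (h z ^+ 2)%:E)%E.
  by apply: integral_ge0 => z _; rewrite lee_fin sqr_ge0.
split=> [[mR mI foo]|[[mR _ Roo] [mI _ Ioo]]].
  have {}mR : measurable_fun (setT : set (X * X)) (sqRe f).
    exact/(measurable_restrictT _ mQ).
  have {}mI : measurable_fun (setT : set (X * X)) (sqIm f).
    exact/(measurable_restrictT _ mQ).
  rewrite sumE// in foo; split; split => //.
  - exact: sqRe0.
  - by apply: le_lt_trans foo; rewrite leeDl.
  - exact: sqIm0.
  - by apply: le_lt_trans foo; rewrite leeDr.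
split; [exact/(measurable_restrictT _ mQ)|exact/(measurable_restrictT _ mQ)|].
by rewrite sumE// lte_add_pinfty.
Qed.

Lemma eqL2P f g : eqL2 f g <-> {ae mu2, forall z, sqRe f z = sqRe g z} /\
  {ae mu2, forall z, sqIm f z = sqIm g z}.
Proof.
split=> [fg|[fgR fgI]].
  split; apply: ae_impl fg => z fg; rewrite /sqRe /sqIm !patchE;
  by case: ifP => // /set_mem /fg ->.
apply: (ae_impl _ (ae_and fgR fgI)) => z [+ + Qz].
by rewrite !sqReE// !sqImE//; exact: complex_ext.
Qed.

Lemma innerE f g : memL2 f -> memL2 g -> inner f g =
  (dot (sqRe f) (sqRe g) + dot (sqIm f) (sqIm g)) +i*
  (dot (sqIm f) (sqRe g) - dot (sqRe f) (sqIm g)).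
Proof.
move=> /memL2P[fR fI] /memL2P[gR gI]; rewrite /inner /cintegral /dot.
rewrite -RintegralD//; try exact: sqint_mul.
rewrite -RintegralB//; try exact: sqint_mul.
congr (_ +i* _); rewrite Rintegral_mkcond; apply: eq_Rintegral => z _;
  rewrite patchE; case: ifPn => [/set_mem Qz|/negP nQ].
- by rewrite !sqReE// !sqImE//; case: (f z) (g z) => [a b] [c e]/=; ring.
- by rewrite !sqRe0 ?sqIm0 ?mulr0 ?addr0// => Qz; apply: nQ; rewrite inE.
- by rewrite !sqReE// !sqImE//; case: (f z) (g z) => [a b] [c e]/=; ring.
- by rewrite !sqRe0 ?sqIm0 ?mulr0 ?subr0// => Qz; apply: nQ; rewrite inE.
Qed.

Lemma sqReZD (c : C) f g : sqRe (fun z => c * f z + g z) =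
  (fun z => complex.Re c * sqRe f z + (- complex.Im c * sqIm f z + sqRe g z)).
Proof.
apply/funext => z; have [Qz|nQz] := pselect (Q z).
  by rewrite !sqReE// sqImE// Re_add Re_mul; ring.
by rewrite !sqRe0// sqIm0// !mulr0 !addr0.
Qed.

Lemma sqImZD (c : C) f g : sqIm (fun z => c * f z + g z) =
  (fun z => complex.Re c * sqIm f z + (complex.Im c * sqRe f z + sqIm g z)).
Proof.
apply/funext => z; have [Qz|nQz] := pselect (Q z).
  by rewrite !sqImE// sqReE// Im_add Im_mul; ring.
by rewrite !sqIm0// sqRe0// !mulr0 !addr0.
Qed.

Lemma memL2ZD (c : C) f g : memL2 f -> memL2 g -> memL2 (fun z => c * f z + g z).
Proof.
move=> /memL2P[fR fI] /memL2P[gR gI]; apply/memL2P; rewrite sqReZD sqImZD.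
by split; do 2 apply: sqintZD => //.
Qed.

Section ComponentwiseOperator.
Variables (A : operator R) (K : (R * R -> R) -> (R * R -> R)).
Hypotheses (AR : forall f, memL2 f -> sqRe (A f) = K (sqRe f))
  (AI : forall f, memL2 f -> sqIm (A f) = K (sqIm f)).
Hypotheses (K_sqint : forall u, sqint u -> sqint (K u))
  (K_ae : forall u v, sqint u -> sqint v -> {ae mu2, forall z, u z = v z} ->
    {ae mu2, forall z, K u z = K v z})
  (K_ZD : forall c u v, sqint u -> sqint v ->
    {ae mu2, forall z, K (fun z => c * u z + v z) z = c * K u z + K v z})
  (K_le : forall u, sqint u -> dot (K u) (K u) <= 4 * dot u u).

(** The real operator [K] is abstract so that the argument serves both [realT] and its conjugate by
    the reflection. A complex scalar mixes the components, hence two uses of real linearity for each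
    of them; the norm bound 2 is the square root of the constant 4. *)
Lemma componentwise_bounded : bounded_operator A.
Proof.
have AL2 f : memL2 f -> memL2 (A f).
  by move=> fL; have /memL2P[fR fI] := fL; apply/memL2P;
    rewrite AR// AI//; split; exact: K_sqint.
split => //.
- move=> f g fL gL /eqL2P[fgR fgI]; apply/eqL2P; rewrite !AR// !AI//.
  move: fL gL => /memL2P[fR fI] /memL2P[gR gI].
  by split; exact: K_ae.
- move=> c f g fL gL; apply/eqL2P.
  rewrite AR ?AI; try exact: memL2ZD.
  rewrite !sqReZD !sqImZD !AR// !AI//.
  move: fL gL => /memL2P[fR fI] /memL2P[gR gI].
  split.
  + have H1 := K_ZD (complex.Re c) fR (sqintZD (- complex.Im c) fI gR).
    have H2 := K_ZD (- complex.Im c) fI gR.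
    by apply: (ae_impl _ (ae_and H1 H2)) => z [-> ->].
  + have H1 := K_ZD (complex.Re c) fI (sqintZD (complex.Im c) fR gI).
    have H2 := K_ZD (complex.Im c) fR gI.
    by apply: (ae_impl _ (ae_and H1 H2)) => z [-> ->].
exists 2 => f fL; rewrite /normL2 !innerE//=; try exact: AL2.
rewrite !AR// !AI//; move: fL => /memL2P[fR fI].
rewrite -[2]gtr0_norm// -sqrtr_sqr -sqrtrM ?sqr_ge0// ler_sqrt.
  by have := K_le fR; have := K_le fI; lra.
by rewrite mulr_ge0 ?sqr_ge0// addr_ge0 ?dot_ge0.
Qed.

End ComponentwiseOperator.

End Components.

(** * The operator and its adjoint on complex functions *)

Section Operators.
Variable R : realType.
Local Notation X := (measurableTypeR R).
Local Notation mu := (@lebesgue_measure R).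
Local Notation mu2 := (mu \x mu)%E.
Local Notation Q := (@unit_square R).
Local Notation C := R[i].
Implicit Types (f g : R * R -> C) (z : R * R).

Lemma sqRe_opT f : sqRe (opT f) = realT (sqRe f).
Proof.
apply/funext => -[x y]; have [Qz|nQz] := pselect (Q (x, y)); last first.
  by rewrite sqRe0// /realT patchE memNset.
rewrite sqReE// /realT patchE mem_set//= Rintegral_mkcond.
apply: eq_Rintegral => t _; rewrite patchE; have [Ix _] := Qz.
case: ifPn => [/set_mem It|/negP nIt].
  by rewrite sqReE; [rewrite [LHS]Re_mul/= mul0r subr0|by split; [exact: It|exact: Ix]].
by rewrite sqRe0 ?mulr0// => -[/= It _]; apply: nIt; rewrite inE.
Qed.


Lemma sqIm_opT f : sqIm (opT f) = realT (sqIm f).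
Proof.
apply/funext => -[x y]; have [Qz|nQz] := pselect (Q (x, y)); last first.
  by rewrite sqIm0// /realT patchE memNset.
rewrite sqImE// /realT patchE mem_set//= Rintegral_mkcond.
apply: eq_Rintegral => t _; rewrite patchE; have [Ix _] := Qz.
case: ifPn => [/set_mem It|/negP nIt].
  by rewrite sqImE; [rewrite [LHS]Im_mul/= mul0r addr0|by split; [exact: It|exact: Ix]].
by rewrite sqIm0 ?mulr0// => -[/= It _]; apply: nIt; rewrite inE.
Qed.

(** The adjoint is introduced as a conjugate by the reflection, so that estimates and null sets
    carry over from [realT]; its explicit kernel is recovered next. *)
Definition realTadj (u : R * R -> R) : R * R -> R :=
  realT (u \o flip (R := R)) \o flip (R := R).

(** Substituting [1 - s] for [s] leaves the identity [chi (1 - s) (1 - y) (1 - x) = chi x y s]: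
    reversing the line and the order of the arguments cancel out. *)
Lemma realTadjE (u : R * R -> R) (x y : R) : measurable_fun (setT : set (X * X)) u ->
  Q (x, y) -> realTadj u (x, y) = \int[mu]_s (chi x y s * u (y, s)).
Proof.
move=> mu' Qxy; rewrite /realTadj/= /realT patchE mem_set; last first.
  exact/unit_square_flip.
rewrite -[RHS]Rintegral_subl; last first.
  apply: measurable_funM; last exact: (measurable_fun_pair2 (f := u)).
  by apply: measurable_fun_ifT => //; last apply: measurable_fun_ifT => //;
    apply: measurable_and => //; apply: measurable_fun_ltr.
apply: eq_Rintegral => s _; rewrite /flip/= subKr; congr (_ * _).
rewrite /chi (_ : (s < 1 - y) = (y < 1 - s)); last first.
  by rewrite ltrBrDr addrC -ltrBrDr.
rewrite (_ : (1 - y < s) = (1 - s < y)); last by rewrite ltrBlDr addrC -ltrBlDr.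
by rewrite !ltrD2l !ltrN2 andbC [(1 - s < y) && _]andbC.
Qed.

Lemma sqRe_opTadj f : memL2 f -> sqRe (opTadj f) = realTadj (sqRe f).
Proof.
move=> /memL2P[[mR _ _] _]; apply/funext => -[x y].
have [Qz|nQz] := pselect (Q (x, y)); last first.
  by rewrite sqRe0// /realTadj/= /realT patchE memNset// => /unit_square_flip.
rewrite sqReE// realTadjE//= Rintegral_mkcond.
apply: eq_Rintegral => t _; rewrite patchE; have [_ Iy] := Qz.
case: ifPn => [/set_mem It|/negP nIt].
  by rewrite sqReE; [rewrite [LHS]Re_mul/= mul0r subr0|by split; [exact: Iy|exact: It]].
by rewrite sqRe0 ?mulr0// => -[_ /= It]; apply: nIt; rewrite inE.
Qed.

Lemma sqIm_opTadj f : memL2 f -> sqIm (opTadj f) = realTadj (sqIm f).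
Proof.
move=> /memL2P[_ [mI _ _]]; apply/funext => -[x y].
have [Qz|nQz] := pselect (Q (x, y)); last first.
  by rewrite sqIm0// /realTadj/= /realT patchE memNset// => /unit_square_flip.
rewrite sqImE// realTadjE//= Rintegral_mkcond.
apply: eq_Rintegral => t _; rewrite patchE; have [_ Iy] := Qz.
case: ifPn => [/set_mem It|/negP nIt].
  by rewrite sqImE; [rewrite [LHS]Im_mul/= mul0r addr0|by split; [exact: Iy|exact: It]].
by rewrite sqIm0 ?mulr0// => -[_ /= It]; apply: nIt; rewrite inE.
Qed.

Lemma ae_flip (P : R * R -> Prop) :
  {ae mu2, forall z, P z} -> {ae mu2, forall z, P (flip z)}.
Proof. exact: (ae_preserving (@measurable_flip R) (@flip_preserving R)). Qed.

Lemma opT_bounded : bounded_operator (@opT R).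
Proof.
apply: (componentwise_bounded (K := @realT R)).
- by move=> f _; exact: sqRe_opT.
- by move=> f _; exact: sqIm_opT.
- exact: sqint_realT.
- by move=> u v [mu' _ _] [mv _ _]; exact: realT_eq_ae.
- exact: realTZD_ae.
- exact: dot_realT_le.
Qed.

Lemma opTadj_bounded : bounded_operator (@opTadj R).
Proof.
apply: (componentwise_bounded (K := realTadj)).
- exact: sqRe_opTadj.
- exact: sqIm_opTadj.
- by move=> u su; apply/sqint_flip/sqint_realT/sqint_flip.
- move=> u v /sqint_flip[mu' _ _] /sqint_flip[mv _ _] uv.
  exact: (ae_flip (realT_eq_ae mu' mv (ae_flip uv))).
- move=> c u v /sqint_flip su /sqint_flip sv.
  exact: (ae_flip (realTZD_ae c su sv)).
move=> u su; have su' := sqint_flip su.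
have cancel w : (w \o flip (R := R)) \o flip (R := R) = w :> (R * R -> R).
  by apply/funext => z /=; rewrite flipK.
rewrite /realTadj dot_flip ?cancel//; last 2 first.
- exact: sqint_realT.
- by apply/sqint_flip/sqint_realT.
apply: le_trans (dot_realT_le su') _.
by rewrite dot_flip// cancel.
Qed.

Lemma opT_adjoint : is_adjoint (@opT R) (@opTadj R).
Proof.
have [TL2 _ _ _] := opT_bounded; have [T'L2 _ _ _] := opTadj_bounded.
move=> f g fL gL; rewrite (innerE (TL2 f fL) gL) (innerE fL (T'L2 g gL)).
rewrite sqRe_opT sqIm_opT (sqRe_opTadj gL) (sqIm_opTadj gL).
move: fL gL => /memL2P[fR fI] /memL2P[gR gI].
by congr ((_ + _) +i* (_ - _)); exact: dot_realT_flip.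
Qed.

Lemma innerZDl (c : C) f g h : memL2 f -> memL2 g -> memL2 h ->
  inner (fun z => c * f z + g z) h = c * inner f h + inner g h.
Proof.
move=> fL gL hL; rewrite !innerE//; last exact: memL2ZD.
move: fL gL hL => /memL2P[fR fI] /memL2P[gR gI] /memL2P[hR hI].
have dotL k u v w : sqint u -> sqint v -> sqint w ->
    dot (fun z => k * u z + v z) w = k * dot u w + dot v w :> R.
  move=> su sv sw; rewrite -(dotZl k su sw) -dotDl//.
  (* [sqintZD] expects a summand with coefficient 1. *)
  have -> : (fun z => k * u z) = (fun z => (k - 1) * u z + u z).
    by apply/funext => z; ring.
  exact: sqintZD.
rewrite sqReZD sqImZD !dotL//; try exact: sqintZD.
case: c => a b; apply: (@complex_ext R);
  rewrite ?Re_add ?Im_add ?Re_mul ?Im_mul/=; ring.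
Qed.

Lemma eq_inner f g h : memL2 f -> memL2 g -> memL2 h -> eqL2 f g ->
  inner f h = inner g h.
Proof.
move=> fL gL hL /eqL2P[eR eI]; rewrite !innerE//.
move: fL gL hL => /memL2P[fR fI] /memL2P[gR gI] /memL2P[hR hI].
by rewrite (eq_dot fR gR hR eR) (eq_dot fR gR hI eR) (eq_dot fI gI hR eI)
  (eq_dot fI gI hI eI).
Qed.

End Operators.

(** * The eigenfunctions *)

Section ColumnIntegrals.
Variable R : realType.
Local Notation X := (measurableTypeR R).
Local Notation mu := (@lebesgue_measure R).
Local Notation Q := (@unit_square R).
Local Notation integrable01 f := (mu.-integrable `[0, 1] (EFin \o f)).
Implicit Types (x t : R) (A B h G : R -> R).

Lemma unit_squareE (x y : R) : Q (x, y) <-> 0 <= x <= 1 /\ 0 <= y <= 1.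
Proof. by rewrite /unit_square /unit_interval /= /setX/= !in_itv. Qed.

(** If [f (x, y)] is [A x + 1_(y < x) B x], then along the column at [x] the indicator becomes that
    of [x < t]. This yields the integral equations for [a] and [b], both for a general eigenfunction
    and for [phi]. *)
Lemma coltot_split (f : R * R -> R) A B x :
  measurable_fun (setT : set (X * X)) f -> (forall z, ~ Q z -> f z = 0) ->
  integrable01 A -> integrable01 B -> 0 <= x <= 1 ->
  {ae mu, forall t, 0 <= t <= 1 -> f (t, x) = A t + (x < t)%R%:R * B t} ->
  coltot (lower f) x = \int[mu]_(t in `]x, 1]) (A t + B t) /\
  coltot f x = \int[mu]_(t in `[0, 1]) A t + \int[mu]_(t in `]x, 1]) B t.
Proof.
move=> mf f0 iA iB x01 fE; have /andP[x0 x1] := x01.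
have m01 : measurable (`[0, 1] : set X) by exact: measurable_itv.
have mx1 : measurable (`]x, 1] : set X) by exact: measurable_itv.
have sub : `]x, 1] `<=` (`[0, 1] : set R).
  by move=> t /=; rewrite !in_itv/= => /andP[? ?]; apply/andP; split; lra.
have iA' := integrableS m01 mx1 sub iA.
have iB' := integrableS m01 mx1 sub iB.
have f0' t : ~ (0 <= t <= 1) -> f (t, x) = 0.
  by move=> nt; apply: f0 => /unit_squareE[].
have iAB : mu.-integrable `]x, 1] (EFin \o (fun t => A t + B t)).
  exact: (integrableD mx1 iA' iB').
have restr D h : measurable (D : set X) -> mu.-integrable D (EFin \o h) ->
    mu.-integrable setT (EFin \o (h \_ D)).
  by move=> mD /(integrable_mkcond _ mD); rewrite restrict_EFin.
have mlow : measurable_fun (setT : set (X * X)) (lower f).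
  by apply: measurable_funM => //; exact: measurable_lt_pair.
split.
  rewrite Rintegral_mkcond; congr fine; apply: ae_eq_integral => //.
  - by apply/measurable_EFinP; exact: measurable_col.
  - exact: (measurable_int _ (restr _ _ mx1 iAB)).
  apply: ae_impl fE => t ft _; congr EFin; rewrite /lower/= patchE.
  have [t01|nt01] := boolP (0 <= t <= 1).
    rewrite ft//; case: ifPn => [/set_mem/=|/negP]; rewrite ?in_itv/=.
      by move=> /andP[-> _]; rewrite /= mul1r mulr1.
    rewrite inE/= in_itv/= => nt; have /andP[_ t1] := t01.
    by case: ltP => xt; [exfalso; apply: nt; rewrite xt|rewrite mulr0].
  rewrite f0' ?mul0r; last exact/negP.
  by case: ifPn => // /set_mem /sub/=; rewrite in_itv/= (negPf nt01).
rewrite (Rintegral_mkcond _ (`[0, 1] : set X)) (Rintegral_mkcond _ (`]x, 1] : set X)).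
rewrite -RintegralD//; [|exact: restr..].
congr fine; apply: ae_eq_integral => //.
- by apply/measurable_EFinP; exact: measurable_col.
- exact: (measurable_int _ (integrableD measurableT (restr _ _ m01 iA)
    (restr _ _ mx1 iB'))).
apply: ae_impl fE => t ft _; congr EFin; rewrite !patchE.
have [t01|nt01] := boolP (0 <= t <= 1).
  rewrite ft// mem_set/=; last by rewrite in_itv.
  congr (_ + _); case: ifPn => [/set_mem/=|/negP]; rewrite ?in_itv/=.
    by move=> /andP[-> _]; rewrite mul1r.
  rewrite inE/= in_itv/= => nt; have /andP[_ t1] := t01.
  by case: ltP => xt; [exfalso; apply: nt; rewrite xt|rewrite mul0r].
rewrite f0'; last exact/negP.
rewrite memNset/=; last by rewrite in_itv/=; exact/negP.
rewrite memNset ?addr0// => /sub/=; rewrite in_itv/=; exact/negP.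
Qed.

Lemma prim_FTC h G x : (forall t, is_derive t 1 G (h t)) ->
  (forall t, {for t, continuous h}) -> 0 <= x -> prim h x = G x - G 0.
Proof.
move=> dG ch; rewrite le_eqVlt => /predU1P[<-|x0].
  by rewrite prim0 subrr.
have cG : continuous G.
  by move=> t; apply/differentiable_continuous/derivable1_diffP; case: (dG t).
rewrite /prim /Rintegral (@continuous_FTC2 R h G 0 x)//.
- by apply: continuous_subspaceT => t; exact: ch.
- split.
  + by move=> t _; case: (dG t).
  + by apply: cvg_at_right_filter; exact: cG.
  + by apply: cvg_at_left_filter; exact: cG.
- by move=> t _; rewrite derive1E; exact: (@derive_val _ _ _ _ _ _ _ (dG t)).
Qed.

Lemma is_derive_expRN t : is_derive t 1 (fun s : R => expR (- s)) (- expR (- t)).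
Proof.
have := is_derive1_comp (is_derive_expR (- t)) (is_deriveN (is_derive_id t 1)).
by move=> /is_derive_eq; apply; ring.
Qed.

Lemma continuous_expRN : continuous (fun s : R => expR (- s)).
Proof.
move=> t; apply/differentiable_continuous/derivable1_diffP.
by case: (is_derive_expRN t).
Qed.

Lemma continuous_lin_expRN (a b : R) :
  continuous (fun s : R => (a - b * s) * expR (- s)).
Proof.
move=> t; apply: (@continuousM _ _ (fun s => a - b * s)); last first.
  exact: continuous_expRN.
apply: (@continuousB _ _ _ (cst a)); first exact: cst_continuous.
by apply: continuousM; [exact: cst_continuous|exact: id].
Qed.

(** The functions [(a - b s) e^(-s)] form a family closed under differentiation, which contains the
    two coefficients of [phi] as well as primitives of them. *)
Lemma is_derive_lin_expRN (a b : R) t :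
  is_derive t 1 (fun s : R => (a - b * s) * expR (- s))
    ((- b - a + b * t) * expR (- t)).
Proof.
have d1 : is_derive t 1 (cst a - b \*: id) (0 - b * 1).
  exact: (is_deriveB (is_derive_cst a t 1) (is_deriveZ b (is_derive_id t 1))).
have := is_deriveM d1 (is_derive_expRN t).
by move=> /is_derive_eq; apply; rewrite !fctE/= /GRing.scale/=; ring.
Qed.

End ColumnIntegrals.

(** * The functions [phi] and [psi] and their inner product *)

Section Eigenfunctions.
Variable R : realType.
Local Notation X := (measurableTypeR R).
Local Notation mu := (@lebesgue_measure R).
Local Notation mu2 := (mu \x mu)%E.
Local Notation I := (@unit_interval R).
Local Notation Q := (@unit_square R).
Local Notation C := R[i].
Local Notation integrable01 f := (mu.-integrable `[0, 1] (EFin \o f)).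
Local Notation flip := (@flip R).
Implicit Types (f g : R * R -> C) (x y t : R).

Definition rphi : R * R -> R := sqRe (@phi R).

Lemma rphiE x y : Q (x, y) ->
  rphi (x, y) = (1 - x) * expR (- x) + (y < x)%R%:R * expR (- x).
Proof.
move=> Qxy; rewrite /rphi sqReE//=; case: leP => _; rewrite /=; ring.
Qed.

Lemma sqIm_phi : sqIm (@phi R) = fun=> 0.
Proof.
by apply/funext => -[x y]; rewrite /sqIm patchE; case: ifP.
Qed.

Lemma sqint_bounded (h : R * R -> R) M : measurable_fun (setT : set (X * X)) h ->
  (forall z, ~ Q z -> h z = 0) -> (forall z, Q z -> `|h z| <= M) -> sqint h.
Proof.
move=> mh h0 hM; split => //; have mQ := @measurable_unit_square R.
apply: (@le_lt_trans _ _ (\int[mu2]_z ((M ^+ 2)%:E * (\1_Q z)%:E))%E).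
  apply: ge0_le_integral => //.
  - by move=> z _; rewrite lee_fin sqr_ge0.
  - by apply/measurable_EFinP; exact: measurable_funX.
  - apply: measurable_funeM; apply/measurable_EFinP; exact: measurable_indic mQ.
  move=> z _; rewrite -EFinM lee_fin indicE.
  have [Qz|nQz] := pselect (Q z); last by rewrite h0// expr0n/= mulr_ge0 ?sqr_ge0.
  rewrite mem_set// mulr1 -real_normK ?num_real//.
  by rewrite lerXn2r ?nnegrE//; [exact: le_trans (hM z Qz)|exact: hM].
rewrite ge0_integralZl//; last 2 first.
- by apply/measurable_EFinP; exact: measurable_indic mQ.
- by rewrite lee_fin sqr_ge0.
rewrite integral_indic// setIT.
by rewrite [X in (_ * X < _)%E](lebesgue_unit_square R) mule1 ltry.
Qed.

Lemma sqint_rphi : sqint rphi.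
Proof.
have mQ := @measurable_unit_square R.
apply: (@sqint_bounded _ 2).
- apply/(measurable_restrictT _ mQ); apply: measurable_funTS.
  rewrite (_ : (fun z => _) = (fun z : X * X => expR (- z.1) *
    (if z.1 <= z.2 then 1 - z.1 else 2 - z.1))); last by apply/funext => -[].
  apply: measurable_funM.
    apply: measurableT_comp => //; apply: measurableT_comp => //.
  apply: measurable_fun_ifT.
  + by apply: measurable_fun_ler.
  + by apply: measurable_funB.
  + by apply: measurable_funB.
- exact: sqRe0.
move=> [x y] Qxy; rewrite rphiE// -mulrDl normrM [`|expR _|]ger0_norm ?expR_ge0//.
have /unit_squareE[/andP[x0 x1] _] := Qxy.
rewrite -[2]mulr1 ler_pM//; last by rewrite -expR0 ler_expR oppr_le0.
by rewrite ler_norml; case: (_ < _) => /=; apply/andP; split; lra.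
Qed.

Lemma memL2_phi : memL2 (@phi R).
Proof.
apply/memL2P; rewrite sqIm_phi; split; first exact: sqint_rphi.
by apply: (@sqint_bounded _ 0) => // z _; rewrite normr0.
Qed.

(** The column integrals of [phi] equal its own coefficients in [rphiE], which is the equation
    [T phi = phi]. *)
Lemma coltot_rphi x : 0 <= x <= 1 ->
  coltot (lower rphi) x = (1 - x) * expR (- x) /\ coltot rphi x = expR (- x).
Proof.
move=> x01; have [mphi phi0 _] := sqint_rphi.
(* The factors [1 * t] and [0 * t] make [A] and [B] literal members of the family
   [(a - b t) e^(-t)]. *)
pose A t : R := (1 - 1 * t) * expR (- t); pose B t : R := (1 - 0 * t) * expR (- t).
have icont h : continuous h -> integrable01 h.
  move=> ch; apply: continuous_compact_integrable; first exact: segment_compact.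
  exact: continuous_subspaceT.
have cA : continuous A by exact: continuous_lin_expRN.
have cB : continuous B by exact: continuous_lin_expRN.
have iA := icont _ cA; have iB := icont _ cB.
have [|-> ->] := coltot_split mphi phi0 iA iB x01.
  apply: aeW => t t01; rewrite rphiE; last exact/unit_squareE.
  by rewrite /A /B; ring.
have AB : (fun t => A t + B t) = (fun t => (2 - 1 * t) * expR (- t)).
  by apply/funext => t; rewrite /A /B; ring.
have x0 : 0 <= x by case/andP: x01.
have pA y : 0 <= y -> prim A y = y * expR (- y).
  have dG t : is_derive t 1 (fun s => (0 - (-1) * s) * expR (- s)) (A t).
    by apply: is_derive_eq (is_derive_lin_expRN _ _ _) _; rewrite /A; ring.
  by move=> y0; rewrite (prim_FTC dG cA y0); ring.
have pB y : 0 <= y -> prim B y = 1 - expR (- y).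
  have dG t : is_derive t 1 (fun s => (-1 - 0 * s) * expR (- s)) (B t).
    by apply: is_derive_eq (is_derive_lin_expRN _ _ _) _; rewrite /B; ring.
  by move=> y0; rewrite (prim_FTC dG cB y0) oppr0 expR0; ring.
rewrite -/(prim A 1) !Rintegral_tail//; last first.
  by rewrite AB; apply: icont; exact: continuous_lin_expRN.
have x1 : x <= 1 by case/andP: x01.
rewrite !(primD iA iB)// !pA// !pB//; split; ring.
Qed.

Lemma Rintegral_zero d (T : measurableType d) (m : {measure set T -> \bar R})
    (h : T -> R) : (forall w, h w = 0) -> \int[m]_w h w = 0.
Proof.
by move=> h0; rewrite (_ : h = cst 0) ?Rintegral_cst ?mul0r//; exact/funext.
Qed.

Lemma coltot_eq0 (u : R * R -> R) x : (forall z, ~ Q z -> u z = 0) ->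
  ~ (0 <= x <= 1) -> coltot u x = 0.
Proof.
by move=> u0 nx; apply: Rintegral_zero => t; apply: u0 => /unit_squareE[].
Qed.

Lemma realT_rphi : {ae mu2, forall z, realT rphi z = rphi z}.
Proof.
apply: ae_impl (realT_ae sqint_rphi) => -[x y] /= TE.
have [Qxy|nQ] := pselect (Q (x, y)); last first.
  by rewrite /realT patchE memNset// /rphi sqRe0.
rewrite TE// rphiE//; have /unit_squareE[x01 _] := Qxy.
by have [-> ->] := coltot_rphi x01.
Qed.

Lemma opT_phi : eqL2 (opT (@phi R)) (@phi R).
Proof.
apply/eqL2P; rewrite sqRe_opT sqIm_opT sqIm_phi; split; first exact: realT_rphi.
apply: aeW => z; rewrite /realT patchE; case: ifP => // _.
by apply: Rintegral_zero => t; rewrite mulr0.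
Qed.

(** The reflection preserves [x <= y], so the conventions on the diagonal match and the equality
    holds at every point. *)
Lemma psiE : @psi R = @phi R \o flip.
Proof.
apply/funext => -[x y]; rewrite /psi /phi /flip/= opprB lerD2l lerN2.
by case: ifP => _; congr ((_ * _)%:C); ring.
Qed.

Lemma sqRe_flip f : sqRe (f \o flip) = sqRe f \o flip.
Proof.
apply/funext => z; have [Qz|nQz] := pselect (Q z).
  by rewrite /= !sqReE//; exact/unit_square_flip.
by rewrite /= !sqRe0// => /unit_square_flip.
Qed.

Lemma sqIm_flip f : sqIm (f \o flip) = sqIm f \o flip.
Proof.
apply/funext => z; have [Qz|nQz] := pselect (Q z).
  by rewrite /= !sqImE//; exact/unit_square_flip.
by rewrite /= !sqIm0// => /unit_square_flip.
Qed.

Lemma memL2_flip f : memL2 f -> memL2 (f \o flip).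
Proof.
by move=> /memL2P[fR fI]; apply/memL2P; rewrite sqRe_flip sqIm_flip;
  split; exact: sqint_flip.
Qed.

Lemma memL2_psi : memL2 (@psi R).
Proof. by rewrite psiE; apply: memL2_flip; exact: memL2_phi. Qed.

(** Replacing the first [phi] by [T phi] makes the density formula available. On [[0, 1]] the
    density is the constant [(1 - x) e^(-x) e^(x - 1) + e^(-x) x e^(x - 1) = 1/e]. *)
Lemma dot_rphi : dot rphi (rphi \o flip) = expR (-1).
Proof.
have sphi := sqint_rphi; have sphi' := sqint_flip sphi.
rewrite -(eq_dot (sqint_realT sphi) sphi sphi' realT_rphi) dot_realT//.
rewrite (_ : dot_density _ _ = (cst (expR (-1))) \_ I).
  rewrite -Rintegral_mkcond Rintegral_cst; last exact: measurable_unit_interval.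
  by rewrite [X in fine X](lebesgue_unit_interval R) mulr1.
apply/funext => x; rewrite /dot_density lower_flip !rowtot_flip//; last first.
  exact: sqint_lower.
have [_ phi0 _] := sphi; have [_ lphi0 _] := sqint_lower sphi.
rewrite patchE; case: ifPn => [/set_mem|/negP nI].
  rewrite /unit_interval/= in_itv/= => x01.
  have x01' : 0 <= 1 - x <= 1 by apply/andP; split; have /andP[] := x01; lra.
  have [-> ->] := coltot_rphi x01; have [-> ->] := coltot_rphi x01'.
  have -> : expR (-1) = expR (- x) * expR (- (1 - x)).
    by rewrite -expRD; congr expR; ring.
  by ring.
have nx : ~ (0 <= x <= 1).
  by move=> x01; apply: nI; rewrite inE /unit_interval/= in_itv.
by rewrite (coltot_eq0 phi0 nx) (coltot_eq0 lphi0 nx) !mul0r addr0.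
Qed.

Lemma inner_phi_psi : inner (@phi R) (@psi R) = (expR (-1))%:C.
Proof.
rewrite innerE; [|exact: memL2_phi|exact: memL2_psi].
rewrite psiE sqRe_flip sqIm_flip sqIm_phi.
rewrite -[sqRe _]/rphi dot_rphi.
have dot0l (u : R * R -> R) : dot (fun=> 0) u = 0.
  by apply: Rintegral_zero => z; rewrite mul0r.
by rewrite [dot rphi _]dotC -/(fun _ => 0) !dot0l subr0 addr0.
Qed.

End Eigenfunctions.

(** * The spectrum *)

Section Spectrum.
Variable R : realType.
Local Notation X := (measurableTypeR R).
Local Notation mu := (@lebesgue_measure R).
Local Notation mu2 := (mu \x mu)%E.
Local Notation Q := (@unit_square R).
Local Notation C := R[i].
Local Notation flip := (@flip R).
Local Notation phi := (@phi R).
Local Notation psi := (@psi R).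
Implicit Types (f g h : R * R -> C) (x y t : R) (c lam : C).

Lemma eqL2_trans g f h : eqL2 f g -> eqL2 g h -> eqL2 f h.
Proof.
by move=> fg gh; apply: (ae_impl _ (ae_and fg gh)) => z [+ + Qz] => -> // ->.
Qed.

(** Dividing by [lam] writes [f] as [lam^-1 T f], which has the shape required by [coltot_split];
    the system then gives eigenvalue and eigenspace together. The case [c = 0] corresponds to the
    zero class. *)
Lemma opT_eigen f lam : memL2 f -> lam != 0 ->
  eqL2 (opT f) (fun z => lam * f z) ->
  exists c, (c != 0 -> lam = 1) /\ eqL2 f (fun z => c * phi z).
Proof.
move=> fL lam0 Tf; have /memL2P[s1 s2] := fL.
pose f1 := sqRe f; pose f2 := sqIm f.
pose p := complex.Re lam^-1; pose q := complex.Im lam^-1.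
pose a1 := coltot (lower f1); pose a2 := coltot (lower f2).
pose b1 := coltot f1; pose b2 := coltot f2.
pose A1 x := p * a1 x - q * a2 x; pose A2 x := p * a2 x + q * a1 x.
pose B1 x := p * b1 x - q * b2 x; pose B2 x := p * b2 x + q * b1 x.
have fE : {ae mu2, forall z, Q z ->
    f1 z = A1 z.1 + (z.2 < z.1)%R%:R * B1 z.1 /\
    f2 z = A2 z.1 + (z.2 < z.1)%R%:R * B2 z.1}.
  have TE := ae_and (realT_ae s1) (realT_ae s2).
  apply: (ae_impl _ (ae_and Tf TE)) => z [+ [+ +]] Qz => /(_ Qz) Tfz.
  move=> /(_ Qz) T1 /(_ Qz) T2.
  have fz : f z = lam^-1 * opT f z by rewrite Tfz mulKf.
  rewrite /f1 /f2 sqReE// sqImE// fz [X in X = _ /\ _]Re_mul [X in _ /\ X = _]Im_mul.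
  rewrite -(sqReE _ Qz) -(sqImE _ Qz) sqRe_opT sqIm_opT T1 T2.
  by rewrite -/p -/q /A1 /A2 /B1 /B2 /a1 /a2 /b1 /b2 /f1 /f2; split; ring.
have m01 : measurable (`[0, 1] : set X) by exact: measurable_itv.
have icol u : sqint u -> mu.-integrable `[0, 1] (EFin \o coltot u).
  by move=> /integrable_coltot; exact: integrableS.
have sl1 := sqint_lower s1; have sl2 := sqint_lower s2.
have ilin (s t : R) (u v : R -> R) : mu.-integrable `[0, 1] (EFin \o u) ->
    mu.-integrable `[0, 1] (EFin \o v) ->
    mu.-integrable `[0, 1] (EFin \o (fun x => s * u x + t * v x)).
  exact: integrable_lin.
have ilinB (s t : R) (u v : R -> R) : mu.-integrable `[0, 1] (EFin \o u) ->
    mu.-integrable `[0, 1] (EFin \o v) ->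
    mu.-integrable `[0, 1] (EFin \o (fun x => s * u x - t * v x)).
  move=> iu iv; have := ilin s (- t) _ _ iu iv.
  rewrite (_ : (fun x => s * u x + - t * v x) = (fun x => s * u x - t * v x))//.
  by apply/funext => x; rewrite mulNr.
have iA1 := ilinB p q _ _ (icol _ sl1) (icol _ sl2).
have iA2 := ilin p q _ _ (icol _ sl2) (icol _ sl1).
have iB1 := ilinB p q _ _ (icol _ s1) (icol _ s2).
have iB2 := ilin p q _ _ (icol _ s2) (icol _ s1).
have [mf1 f10 _] := s1; have [mf2 f20 _] := s2.
have [|[c1 c2]/= [pq cE]] := @eigen_system R p q a1 a2 b1 b2
    (icol _ sl1) (icol _ sl2) (icol _ s1) (icol _ s2).
  apply: ae_impl (ae_product2 fE) => x fxE x01.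
  have [|E1 E2] := coltot_split mf1 f10 iA1 iB1 x01.
    by apply: ae_impl fxE => t ft t01; case: ft => //; exact/unit_squareE.
  have [|E3 E4] := coltot_split mf2 f20 iA2 iB2 x01.
    by apply: ae_impl fxE => t ft t01; case: ft => //; exact/unit_squareE.
  by split.
exists (c1 +i* c2); split.
  move=> c0; have [p1 q0] : p = 1 /\ q = 0.
    by apply: pq; apply: contra c0 => /eqP[-> ->].
  rewrite -[lam]invrK (_ : lam^-1 = 1) ?invr1//.
  exact: (@complex_ext R).
have cE2 := ae_product_fst mu cE.
apply: (ae_impl _ (ae_and fE cE2)) => -[x y] [+ +] Qxy => /(_ Qxy)/=[F1 F2].
have /unit_squareE[x01 _] := Qxy; move=> /(_ x01)[Ea1 Ea2 Eb1 Eb2].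
have phR := rphiE Qxy; rewrite /rphi sqReE// in phR.
have phI : complex.Im (phi (x, y)) = 0 by [].
rewrite /f1 sqReE// in F1; rewrite /f2 sqImE// in F2.
(* The coefficients of [f] are [lam^-1 a] and [lam^-1 b]. They coincide with [a] and [b] in both
   cases, since either everything vanishes or [lam^-1 = 1]. *)
have cpq : (c1, c2) = (0, 0) \/ (p = 1 /\ q = 0).
  by have [->|/pq] := eqVneq (c1, c2) (0, 0); [left|right].
apply: (@complex_ext R).
  rewrite F1 [RHS]Re_mul phR phI /A1 /B1 Ea1 Ea2 Eb1 Eb2/=.
  by case: cpq => [[-> ->]|[-> ->]]; ring.
rewrite F2 [RHS]Im_mul phR phI /A2 /B2 Ea1 Ea2 Eb1 Eb2/=.
by case: cpq => [[-> ->]|[-> ->]]; ring.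
Qed.

Lemma phi_neq0 : ~ eqL2 phi (fun=> 0).
Proof.
move=> phi0; have phiL := memL2_phi R; have psiL := memL2_psi R.
(* The zero function is written as a combination of [phi] with itself so that linearity evaluates
   its inner product, contradicting the value [1/e]. *)
have : inner phi psi = inner (fun z => -1 * phi z + phi z) psi.
  apply: eq_inner => //; first exact: memL2ZD.
  by apply: ae_impl phi0 => z /[apply] ->; rewrite mulr0 addr0.
rewrite innerZDl// mulN1r addNr inner_phi_psi => /eqP.
by rewrite eq_complex/= gt_eqF ?expR_gt0.
Qed.

Lemma eigenfunction_phi : eigenfunction (@opT R) 1 phi.
Proof.
split; [exact: memL2_phi|exact: phi_neq0|].
by under eq_fun do rewrite mul1r; exact: opT_phi.
Qed.

Lemma eqL2_scale0 f : eqL2 f (fun z => 0 * phi z) -> eqL2 f (fun=> 0).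
Proof. by under eq_fun do rewrite mul0r. Qed.

Lemma opT_eigenvalue lam : lam != 0 -> op_eigenvalue (@opT R) lam <-> lam = 1.
Proof.
move=> lam0; split=> [[f [fL fn0 Tf]]|->]; last first.
  by exists phi; exact: eigenfunction_phi.
have [c [clam fc]] := opT_eigen fL lam0 Tf.
apply: clam; apply/eqP => c0; apply: fn0.
by apply: eqL2_scale0; rewrite c0 in fc.
Qed.

Lemma opT_kernel f : memL2 f -> eqL2 (opT f) f ->
  exists c, eqL2 f (fun z => c * phi z).
Proof.
move=> fL Tf; have [|c [_ ?]] := opT_eigen fL (oner_neq0 _); last by exists c.
by under eq_fun do rewrite mul1r.
Qed.

Lemma eqL2_flip f g : eqL2 f g -> eqL2 (f \o flip) (g \o flip).
Proof. by move=> /ae_flip; apply: ae_impl => z fg /unit_square_flip. Qed.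

Lemma opT_flip f : memL2 f -> eqL2 (opT (f \o flip)) (opTadj f \o flip).
Proof.
move=> fL; apply/eqL2P.
rewrite sqRe_opT sqIm_opT !sqRe_flip !sqIm_flip sqRe_opTadj// sqIm_opTadj//.
by split; apply: aeW => z; rewrite /realTadj/= flipK.
Qed.

Lemma opTadj_flip f : memL2 f -> eqL2 (opTadj (f \o flip)) (opT f \o flip).
Proof.
move=> fL; have fL' := memL2_flip fL; apply/eqL2P.
rewrite sqRe_opTadj// sqIm_opTadj// !sqRe_flip !sqIm_flip sqRe_opT sqIm_opT.
have cancel (u : R * R -> R) : (u \o flip) \o flip = u.
  by apply/funext => z /=; rewrite flipK.
by rewrite /realTadj !cancel; split; exact: aeW.
Qed.

Lemma flip_comp f : (f \o flip) \o flip = f.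
Proof. by apply/funext => z /=; rewrite flipK. Qed.

Lemma opTadj_psi : eqL2 (opTadj psi) psi.
Proof.
rewrite psiE; apply: eqL2_trans (opTadj_flip (memL2_phi R)) _.
by apply: eqL2_flip; exact: opT_phi.
Qed.

Lemma eigenfunction_psi : eigenfunction (@opTadj R) 1 psi.
Proof.
split; first exact: memL2_psi.
  by rewrite psiE => /eqL2_flip; rewrite flip_comp; exact: phi_neq0.
by under eq_fun do rewrite mul1r; exact: opTadj_psi.
Qed.

(** By induction [(T - 1) f] is a multiple [c phi]. Pairing with [psi] gives [c / e = 0], so [f]
    already lies in the kernel of [T - 1]: the chain of generalized kernels stops at the first
    one. *)
Lemma opT_generalized f k : memL2 f ->
  eqL2 (iter k (fun g z => opT g z - 1 * g z) f) (fun=> 0) ->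
  exists c, eqL2 f (fun z => c * phi z).
Proof.
have phiL := memL2_phi R; have psiL := memL2_psi R.
have [TL2 _ _ _] := opT_bounded R; have [T'L2 _ _ _] := opTadj_bounded R.
elim: k f => [|k IH] f fL.
  by move=> f0; exists 0; under eq_fun do rewrite mul0r.
rewrite iterSr; set Sf := (fun z => opT f z - 1 * f z).
have SfE : Sf = (fun z => -1 * f z + opT f z).
  by apply/funext => z; rewrite /Sf mul1r mulN1r addrC.
have SfL : memL2 Sf by rewrite SfE; apply: memL2ZD => //; exact: TL2.
move=> /(IH _ SfL)[c Sfc].
have zeroE : (fun z => c * phi z) = (fun z => c * phi z + (-1 * phi z + phi z)).
  by apply/funext => z; rewrite mulN1r addNr addr0.
have ceq : c * inner phi psi = 0.
  have := eq_inner SfL _ psiL Sfc.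
  rewrite zeroE innerZDl//; last exact: memL2ZD.
  rewrite innerZDl// mulN1r addNr addr0 => <-; last first.
    by apply: memL2ZD => //; exact: memL2ZD.
  rewrite SfE innerZDl//; last exact: TL2.
  have -> : inner (opT f) psi = inner f psi.
    rewrite (opT_adjoint fL psiL).
    (* [eq_inner] changes only the left argument, so conjugate symmetry is used to replace [T^* psi]
       by [psi] on the right. *)
    have conjE g : memL2 g -> inner f g = (inner g f)^*.
      move=> gL; rewrite !innerE//; apply: (@complex_ext R) => /=.
        by rewrite [dot (sqRe f) _]dotC [dot (sqIm f) _]dotC.
      by rewrite [dot (sqRe f) _]dotC [dot (sqIm f) _]dotC opprB.
    rewrite !conjE//; last exact: T'L2.
    congr (_^*); apply: eq_inner => //; first exact: T'L2.
    exact: opTadj_psi.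
  by rewrite mulN1r addNr.
have c0 : c = 0.
  move/eqP: ceq; rewrite inner_phi_psi mulf_eq0 => /orP[/eqP//|].
  by rewrite eq_complex/= gt_eqF ?expR_gt0.
apply: opT_kernel => //.
by apply: ae_impl Sfc => z + Qz => /(_ Qz); rewrite c0 mul0r /Sf mul1r => /eqP;
  rewrite subr_eq0 => /eqP.
Qed.

Lemma simple_eigenvalue_opT : simple_eigenvalue (@opT R) 1.
Proof.
split; first by exists phi; exact: eigenfunction_phi.
exists (fun=> phi); split.
- move=> i; split; first exact: memL2_phi.
  exists 1%N => /=; apply: ae_impl (opT_phi R) => z /[apply] ->.
  by rewrite mul1r subrr.
- move=> c; under eq_fun do rewrite big_ord1.
  move=> cphi i; rewrite (ord1 i); apply/eqP/negPn/negP => c0; apply: phi_neq0.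
  by apply: ae_impl cphi => z /[apply] /eqP; rewrite mulf_eq0 (negPf c0) => /eqP.
- move=> f [fL [k fk]]; have [c fc] := opT_generalized fL fk.
  by exists (fun=> c); under eq_fun do rewrite big_ord1.
Qed.

Lemma the_eigenfunction_phi : the_eigenfunction (@opT R) 1 phi.
Proof.
split; first exact: eigenfunction_phi.
move=> g [gL _ Tg]; apply: opT_kernel => //.
by move: Tg; under eq_fun do rewrite mul1r.
Qed.

(** The reflection of an eigenfunction of the adjoint is an eigenfunction of [T], hence a multiple
    of [phi]; reflecting back gives a multiple of [psi]. *)
Lemma the_eigenfunction_psi : the_eigenfunction (@opTadj R) 1 psi.
Proof.
split; first exact: eigenfunction_psi.
move=> g [gL _ Tg].
have {}Tg : eqL2 (opTadj g) g by move: Tg; under eq_fun do rewrite mul1r.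
have [c gc] := opT_kernel (memL2_flip gL)
  (eqL2_trans (opT_flip gL) (eqL2_flip Tg)).
by exists c; move: gc => /eqL2_flip; rewrite flip_comp psiE.
Qed.

End Spectrum.

Theorem theorem6p1 (R : realType) :
  [/\ bounded_operator (@opT R),
      bounded_operator (@opTadj R) &
      is_adjoint (@opT R) (@opTadj R)] /\
  [/\ forall lam : R[i], lam != 0 -> (op_eigenvalue (@opT R) lam <-> lam = 1),
      simple_eigenvalue (@opT R) 1,
      the_eigenfunction (@opT R) 1 (@phi R) &
      the_eigenfunction (@opTadj R) 1 (@psi R)].
Proof.
split; split.
- exact: opT_bounded.
- exact: opTadj_bounded.
- exact: opT_adjoint.
- exact: opT_eigenvalue.
- exact: simple_eigenvalue_opT.
- exact: the_eigenfunction_phi.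
- exact: the_eigenfunction_psi.
Qed.
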